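(* For all $r\ge0$, the adjunction $\mathrm{Shift}\dashv\mathrm{Dec}$ gives a Quillen equivalence between $\mathrm{ESpSe}'_r$ and $\mathrm{ESpSe}'_{r+1}$ (with $\mathrm{Shift}\colon\mathrm{ESpSe}'_r\to\mathrm{ESpSe}'_{r+1}$ the left Quillen functor). And for all $r\ge0$ the adjunction $\mathrm{LDec}\dashv\mathrm{Shift}$ gives a Quillen equivalence between $\mathrm{ESpSe}'_{r+1}$ and $\mathrm{ESpSe}'_r$ (with $\mathrm{LDec}\colon\mathrm{ESpSe}'_{r+1}\to\mathrm{ESpSe}'_r$ the left Quillen functor).
   Context: $R$ is a commutative ring with unit. A bigraded module is a family $A=\{A^{p,n}\}_{p,n\in\mathbb Z}$ of $R$-modules. For $r\ge 0$, an $r$-bigraded complex is a bigraded module with $R$-linear maps $d_r\colon A^{p,n}\to A^{p-r,n+1-r}$, $d_r^2=0$; morphisms are bidegree-preserving maps commuting with $d_r$; $H(A)=\ker d_r/\operatorname{im} d_r$; a quasi-isomorphism is a morphism inducing an isomorphism on $H$. Extended spectral sequence $(X,\varphi)$: a family of $r$-bigraded complexes $(X_r,d_r)$, $r\ge0$, with morphisms of bigraded modules $\varphi_{r+1}\colon X_{r+1}\to H(X_r)$ (characteristic maps). A morphism $f\colon X\to Y$ is a family of morphisms of $r$-bigraded complexes $f_r\colon X_r\to Y_r$ with $\varphi^Y_{r+1}f_{r+1}=H(f_r)\varphi^X_{r+1}$. The category is $\mathrm{ESpSe}$. $\mathrm{ESpSe}'_r$ is the model category structure on $\mathrm{ESpSe}$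 whose fibrations are the maps $f$ with $f_i$ bidegreewise surjective for $0\le i\le r$ and whose weak equivalences are the maps $f$ such that $f_r$ is a quasi-isomorphism and $f_i$ is an isomorphism for $i>r$. Translation: for an $r$-bigraded complex $A$, $(\mathcal TA)^{p,n}=A^{n,2n-p}$ with the differential of $A$ is an $(r+1)$-bigraded complex; this is an isomorphism of categories from $r$-bigraded to $(r+1)$-bigraded complexes. $\mathrm{Shift}\colon\mathrm{ESpSe}\to\mathrm{ESpSe}$ is (up to natural isomorphism) given by $\mathrm{Shift}(X)_0=\mathcal T(X_0)$ with zero differential, $\mathrm{Shift}(X)_i=\mathcal T(X_{i-1})$ for $i\ge1$, with characteristic maps $\varphi_1=\mathrm{id}$, $\varphi_i=\mathcal T(\varphi^X_{i-1})$ for $i\ge2$. $\mathrm{LDec}$ and $\mathrm{Dec}$ denote respectively its left and right adjoint (both exist, and are therefore determined up to natural isomorphism). Explicitly, $\mathrm{Dec}(X)_0=\mathcal T^{-1}(\mathcal N(X)_1)$ and $\mathrm{Dec}(X)_i=\mathcal T^{-1}(X_{i+1})$ for $i\ge1$, where $\mathcal N(X)_1$ is the $1$-bigraded complex with $\mathcal N(X)_1^{p,n}$ the module of $(x_0,x_1;y_0,y_1)$, $x_i\in X_i^{p,n}$, $y_i\in X_i^{p-1,n}$, $d_0x_0=0$, $\varphi_1(x_1)=[x_0]$, $d_0y_0=0$, $\varphi_1(y_1)=[y_0]$, $d_1x_1=y_1$, and differential $(x_0,x_1;y_0,y_1)\mapsto(y_0,y_1;0,0)$; the characteristic maps are $\varphi_1=\mathcal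 T^{-1}(H(\rho_1)^{-1}\varphi_2^X)$, with $\rho_1\colon\mathcal N(X)_1\to X_1$, $(x_0,x_1;y_0,y_1)\mapsto x_1$, a quasi-isomorphism, and $\varphi_i=\mathcal T^{-1}(\varphi_{i+1}^X)$ for $i\ge2$. *)

(* Defs.v *)
From HB Require Import structures.
From mathcomp Require Import all_boot all_order all_algebra.
From mathcomp Require Import boolp zify.

Set Implicit Arguments.
Unset Strict Implicit.
Unset Printing Implicit Defensive.

Import GRing.Theory.
Local Open Scope ring_scope.
Local Open Scope quotient_scope.

Record category := Category {
  obj :> Type;
  hom : obj -> obj -> Type;
  idm : forall A, hom A A;
  mcomp : forall A B C, hom B C -> hom A B -> hom A C;
  mcompA : forall A B C D (h : hom C D) (g : hom B C) (f : hom A B),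
    mcomp h (mcomp g f) = mcomp (mcomp h g) f;
  mcomp1m : forall A B (f : hom A B), mcomp (idm B) f = f;
  mcompm1 : forall A B (f : hom A B), mcomp f (idm A) = f }.

Arguments idm {c} A.
Arguments mcomp {c A B C}.
Notation "g \oc f" := (mcomp g f) (at level 40, left associativity).

Definition is_iso (C : category) (A B : C) (f : hom A B) : Prop :=
  exists g : hom B A, g \oc f = idm A /\ f \oc g = idm B.

Definition is_initial (C : category) (I : C) : Prop :=
  forall X : C, exists! f : hom I X, True.

Definition is_terminal (C : category) (T : C) : Prop :=
  forall X : C, exists! f : hom X T, True.

Record functor (C D : category) := Functor {
  fobj :> C -> D;
  fmap : forall A B, hom A B -> hom (fobj A) (fobj B);
  fmap_id : forall A, fmap (idm A) = idm (fobj A);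
  fmap_comp : forall A B E (g : hom B E) (f : hom A B),
    fmap (g \oc f) = fmap g \oc fmap f }.

Arguments fmap {C D} F {A B} _ : rename.

Record adjunction (C D : category) (F : functor C D) (G : functor D C) :=
  Adjunction {
    adj : forall X Y, hom (F X) Y -> hom X (G Y);
    adj_bij : forall X Y, bijective (@adj X Y);
    adj_natl : forall X X' Y (u : hom X' X) (f : hom (F X) Y),
      adj (f \oc fmap F u) = adj f \oc u;
    adj_natr : forall X Y Y' (v : hom Y Y') (f : hom (F X) Y),
      adj (v \oc f) = fmap G v \oc adj f }.

Arguments adj {C D F G} a {X Y}.

Definition has_lift (C : category) (A B X Y : C) (i : hom A B) (p : hom X Y) :=
  forall (u : hom A X) (v : hom B Y), p \oc u = v \oc i ->
  exists h : hom B X, h \oc i = u /\ p \oc h = v.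

Definition is_retract (C : category) (A B X Y : C)
    (f : hom A B) (g : hom X Y) : Prop :=
  exists (s : hom A X) (t : hom B Y) (s' : hom X A) (t' : hom Y B),
    [/\ s' \oc s = idm A, t' \oc t = idm B,
        g \oc s = t \oc f & f \oc s' = t' \oc g].

Record model_structure (C : category) := ModelStructure {
  weq : forall A B : C, hom A B -> Prop;
  cof : forall A B : C, hom A B -> Prop;
  fib : forall A B : C, hom A B -> Prop;
  weq_comp : forall (A B E : C) (g : hom B E) (f : hom A B),
    weq f -> weq g -> weq (g \oc f);
  weq_cancell : forall (A B E : C) (g : hom B E) (f : hom A B),
    weq g -> weq (g \oc f) -> weq f;
  weq_cancelr : forall (A B E : C) (g : hom B E) (f : hom A B),
    weq f -> weq (g \oc f) -> weq g;
  weq_retract : forall (A B X Y : C) (f : hom A B) (g : hom X Y),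
    is_retract f g -> weq g -> weq f;
  cof_retract : forall (A B X Y : C) (f : hom A B) (g : hom X Y),
    is_retract f g -> cof g -> cof f;
  fib_retract : forall (A B X Y : C) (f : hom A B) (g : hom X Y),
    is_retract f g -> fib g -> fib f;
  cof_lift : forall (A B X Y : C) (i : hom A B) (p : hom X Y),
    cof i -> fib p -> weq p -> has_lift i p;
  tcof_lift : forall (A B X Y : C) (i : hom A B) (p : hom X Y),
    cof i -> weq i -> fib p -> has_lift i p;
  cof_tfib_factor : forall (A B : C) (f : hom A B),
    exists (E : C) (i : hom A E) (p : hom E B),
      [/\ cof i, fib p, weq p & p \oc i = f];
  tcof_fib_factor : forall (A B : C) (f : hom A B),
    exists (E : C) (i : hom A E) (p : hom E B),
      [/\ cof i, weq i, fib p & p \oc i = f] }.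

Arguments weq {C} m {A B}.
Arguments cof {C} m {A B}.
Arguments fib {C} m {A B}.

Definition cofibrant (C : category) (M : model_structure C) (X : C) : Prop :=
  forall (I : C) (i : hom I X), is_initial I -> cof M i.

Definition fibrant (C : category) (M : model_structure C) (X : C) : Prop :=
  forall (T : C) (t : hom X T), is_terminal T -> fib M t.

Definition left_quillen (C D : category) (M : model_structure C)
    (N : model_structure D) (F : functor C D) : Prop :=
  (forall (A B : C) (f : hom A B), cof M f -> cof N (fmap F f)) /\
  (forall (A B : C) (f : hom A B),
     cof M f -> weq M f -> cof N (fmap F f) /\ weq N (fmap F f)).

Definition quillen_equivalence (C D : category) (M : model_structure C)
    (N : model_structure D) (F : functor C D) (G : functor D C)
    (a : adjunction F G) : Prop :=
  left_quillen M N F /\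
  (forall (X : C) (Y : D) (f : hom (F X) Y),
     cofibrant M X -> fibrant N Y -> (weq N f <-> weq M (adj a f))).

Lemma linear_ext (R : pzRingType) (U V : lmodType R)
  (f g : {linear U -> V}) : f =1 g -> f = g.
Proof.
case: f g => [f cf] [g cg] /= /funext fg; case: g / fg cg => cg.
congr GRing.Linear.Pack.
case: cf cg => [[cf1] [cf2]] [[cg1] [cg2]].
by rewrite (Prop_irrelevance cf1 cg1) (Prop_irrelevance cf2 cg2).
Qed.

Section Subquotient.
Variables (R : pzRingType) (V : lmodType R) (Z B : submodClosed V).

Record submod := Submod { submod_val : V; _ : submod_val \in Z }.

HB.instance Definition _ := [isSub for submod_val].
HB.instance Definition _ := [Choice of submod by <:].
HB.instance Definition _ := [SubChoice_isSubLmodule of submod by <:].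

Fact submod_val_linear : linear submod_val.
Proof. by move=> a x y. Qed.
HB.instance Definition _ :=
  GRing.isLinear.Build R submod V _ submod_val submod_val_linear.

Definition inner (x : submod) : bool := submod_val x \in B.

Fact inner_closed : subsemimod_closed inner.
Proof.
split=> [|a x xB]; last by rewrite unfold_in /inner linearZ; exact: rpredZ.
split=> [|x y xB yB]; rewrite unfold_in /inner; first by rewrite raddf0 rpred0.
by rewrite raddfD; exact: rpredD.
Qed.
HB.instance Definition _ :=
  GRing.isSubmodClosed.Build R submod inner inner_closed.

(* Z / (Z :&: B); no inclusion B <= Z is required. *)
Definition subquot := Quotient.quot (GRing.ZmodClosed.clone submod inner _).

HB.instance Definition _ := GRing.Zmodule.on subquot.
HB.instance Definition _ := EqQuotient.on subquot.

Definition subquot_pi (x : submod) : subquot := \pi_subquot x.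

Lemma subquot_piP (x y : submod) :
  subquot_pi x = subquot_pi y <-> submod_val x - submod_val y \in B.
Proof.
rewrite -raddfB.
split=> [/eqP|h]; last apply/eqP.
  by rewrite -Quotient.idealrBE.
by rewrite -Quotient.idealrBE.
Qed.

Lemma subquot_reprK (c : subquot) : subquot_pi (repr c) = c.
Proof. exact: reprK. Qed.

Fact subquot_piD : {morph subquot_pi : x y / x + y}.
Proof. by move=> x y; rewrite /subquot_pi raddfD. Qed.

Definition subquot_scale (a : R) (c : subquot) : subquot :=
  subquot_pi (a *: repr c).

Fact subquot_scaleE a x : subquot_scale a (subquot_pi x) = subquot_pi (a *: x).
Proof.
apply/subquot_piP; rewrite -[X in X \in _](scalerBr a (submod_val _) (submod_val x)) rpredZ //.
by apply/subquot_piP; rewrite subquot_reprK.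
Qed.

Fact subquot_scaleA a b c :
  subquot_scale a (subquot_scale b c) = subquot_scale (a * b) c.
Proof. by rewrite -(subquot_reprK c) !subquot_scaleE scalerA. Qed.

Fact subquot_scale1 : left_id 1 subquot_scale.
Proof. by move=> c; rewrite -(subquot_reprK c) subquot_scaleE scale1r. Qed.

Fact subquot_scaleDr : right_distributive subquot_scale +%R.
Proof.
move=> a c c'; rewrite -(subquot_reprK c) -(subquot_reprK c').
by rewrite -subquot_piD !subquot_scaleE scalerDr subquot_piD.
Qed.

Fact subquot_scaleDl c :
  {morph subquot_scale^~ c : a b / a + b}.
Proof.
move=> a b; rewrite -(subquot_reprK c).
by rewrite !subquot_scaleE scalerDl subquot_piD.
Qed.

HB.instance Definition _ := GRing.Zmodule_isLmodule.Build R subquot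
  subquot_scaleA subquot_scale1 subquot_scaleDr subquot_scaleDl.

Fact subquot_pi_linear : linear subquot_pi.
Proof. by move=> a x y; rewrite subquot_piD -subquot_scaleE. Qed.
HB.instance Definition _ :=
  GRing.isLinear.Build R submod subquot _ subquot_pi subquot_pi_linear.

End Subquotient.

Section SubquotientMap.
Variables (R : pzRingType) (V V' : lmodType R).
Variables (Z B : submodClosed V) (Z' B' : submodClosed V').
Variable f : {linear V -> V'}.
Hypothesis fZ : {homo f : x / x \in Z >-> x \in Z'}.
Hypothesis fB : {homo f : x / x \in B >-> x \in B'}.

Definition submod_map (x : submod Z) : submod Z' :=
  Submod (fZ (valP x)).

Definition subquot_fun (c : subquot Z B) : subquot Z' B' :=
  subquot_pi B' (submod_map (repr c)).

Lemma subquot_funE (x : submod Z) :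
  subquot_fun (subquot_pi B x) = subquot_pi B' (submod_map x).
Proof.
apply/subquot_piP => /=; rewrite -raddfB; apply: fB.
by apply/subquot_piP; rewrite subquot_reprK.
Qed.

Fact subquot_fun_linear : linear subquot_fun.
Proof.
move=> a c c'; rewrite -(subquot_reprK c) -(subquot_reprK c').
rewrite -linearP !subquot_funE -linearP; congr subquot_pi.
by apply: val_inj; rewrite /= !linearP.
Qed.
HB.instance Definition _ := GRing.isLinear.Build R _ _ _
  subquot_fun subquot_fun_linear.

Definition subquot_map : {linear subquot Z B -> subquot Z' B'} := subquot_fun.

End SubquotientMap.

Lemma subquot_mapE (R : pzRingType) (V V' : lmodType R)
    (Z B : submodClosed V) (Z' B' : submodClosed V') (f : {linear V -> V'})
    (fZ : {homo f : x / x \in Z >-> x \in Z'})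
    (fB : {homo f : x / x \in B >-> x \in B'}) (x : submod Z) :
  subquot_map fZ fB (subquot_pi B x) = subquot_pi B' (submod_map fZ x).
Proof. exact: subquot_funE. Qed.

Section Bigraded.
Variable R : comPzRingType.

Definition bigraded := int -> int -> lmodType R.

Definition bghom (A B : bigraded) := forall p n, {linear A p n -> B p n}.

Lemma bghom_ext (A B : bigraded) (f g : bghom A B) :
  (forall p n, f p n =1 g p n) -> f = g.
Proof. by move=> fg; do 2![apply: functional_extensionality_dep => ?];
  apply: linear_ext. Qed.

Definition bgid (A : bigraded) : bghom A A := fun p n => idfun.

Definition bgcomp (A B C : bigraded) (g : bghom B C) (f : bghom A B) :
  bghom A C := fun p n => g p n \o f p n.

Fact bgcompA A B C D (h : bghom C D) (g : bghom B C) (f : bghom A B) :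
  bgcomp h (bgcomp g f) = bgcomp (bgcomp h g) f.
Proof. exact: bghom_ext. Qed.

Fact bgcomp1m A B (f : bghom A B) : bgcomp (@bgid B) f = f.
Proof. exact: bghom_ext. Qed.

Fact bgcompm1 A B (f : bghom A B) : bgcomp f (@bgid A) = f.
Proof. exact: bghom_ext. Qed.

Definition BgMod : category := Category bgcompA bgcomp1m bgcompm1.

(* The component of d_r at (p, n) is given for every presentation (p', n') of
   the target bidegree (p - r, n + 1 - r); this avoids transports along
   equalities of bidegrees. As int has decidable equality, the data amounts to
   one linear map A p n -> A (p - r) (n + 1 - r) for each (p, n). *)
Record cpx (r : nat) := Cpx {
  cpx_mod :> int -> int -> lmodType R;
  diff : forall p n p' n', p' = p - r%:Z -> n' = n + 1 - r%:Z ->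
    {linear cpx_mod p n -> cpx_mod p' n'};
  diff_diff : forall p n p' n' p'' n''
    (e1 : p' = p - r%:Z) (e2 : n' = n + 1 - r%:Z)
    (e3 : p'' = p' - r%:Z) (e4 : n'' = n' + 1 - r%:Z) (x : cpx_mod p n),
    diff e3 e4 (diff e1 e2 x) = 0 }.

Arguments diff {r} A {p n p' n'} e1 e2 : rename.

Record cpxhom (r : nat) (A B : cpx r) := Cpxhom {
  cpx_map :> forall p n, {linear A p n -> B p n};
  cpx_map_diff : forall p n p' n' (e1 : p' = p - r%:Z)
    (e2 : n' = n + 1 - r%:Z) (x : A p n),
    cpx_map p' n' (diff A e1 e2 x) = diff B e1 e2 (cpx_map p n x) }.

Lemma cpxhom_ext r (A B : cpx r) (f g : cpxhom A B) :
  (forall p n, f p n =1 g p n) -> f = g.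
Proof.
case: f g => f df [g dg] /= fg.
have {}fg : f = g by apply: (@bghom_ext A B).
by rewrite -fg in dg *; rewrite (Prop_irrelevance df dg).
Qed.

Section CpxCategory.
Variable r : nat.

Definition cpxid (A : cpx r) : cpxhom A A :=
  @Cpxhom r A A (@bgid A) (fun _ _ _ _ _ _ _ => erefl).

Fact cpxcomp_diff (A B C : cpx r) (g : cpxhom B C) (f : cpxhom A B)
    p n p' n' (e1 : p' = p - r%:Z) (e2 : n' = n + 1 - r%:Z) (x : A p n) :
  bgcomp g f p' n' (diff A e1 e2 x) = diff C e1 e2 (bgcomp g f p n x).
Proof. by rewrite /= !cpx_map_diff. Qed.

Definition cpxcomp (A B C : cpx r) (g : cpxhom B C) (f : cpxhom A B) :
  cpxhom A C := Cpxhom (cpxcomp_diff g f).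

Fact cpxcompA (A B C D : cpx r)
    (h : cpxhom C D) (g : cpxhom B C) (f : cpxhom A B) :
  cpxcomp h (cpxcomp g f) = cpxcomp (cpxcomp h g) f.
Proof. exact: cpxhom_ext. Qed.

Fact cpxcomp1m (A B : cpx r) (f : cpxhom A B) : cpxcomp (cpxid B) f = f.
Proof. exact: cpxhom_ext. Qed.

Fact cpxcompm1 (A B : cpx r) (f : cpxhom A B) : cpxcomp f (cpxid A) = f.
Proof. exact: cpxhom_ext. Qed.

Definition CpxCat : category := Category cpxcompA cpxcomp1m cpxcompm1.

Definition is_cycle (A : cpx r) p n : pred (A p n) :=
  fun x => diff A (erefl (p - r%:Z)) (erefl (n + 1 - r%:Z)) x == 0.

Fact cycle_closed (A : cpx r) p n : subsemimod_closed (@is_cycle A p n).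
Proof.
split=> [|a x /eqP dx]; last first.
  by apply/eqP; rewrite linearZ dx; exact: scaler0.
split=> [|x y /eqP dx /eqP dy]; apply/eqP; first exact: raddf0.
by rewrite (linearD (diff A _ _)) dx dy; exact: addr0.
Qed.
HB.instance Definition _ (A : cpx r) p n :=
  GRing.isSubmodClosed.Build R (A p n) (@is_cycle A p n) (@cycle_closed A p n).

Fact prev_p (p : int) : p = (p + r%:Z) - r%:Z.
Proof. by rewrite addrK. Qed.

Fact prev_n (n : int) : n = (n - 1 + r%:Z) + 1 - r%:Z.
Proof. by rewrite addrAC addrK subrK. Qed.

Definition is_boundary (A : cpx r) p n : pred (A p n) :=
  fun x => `[< exists y, diff A (prev_p p) (prev_n n) y = x >].

Fact boundary_closed (A : cpx r) p n : subsemimod_closed (@is_boundary A p n).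
Proof.
split=> [|a _ /asboolP [y <-]]; last first.
  by apply/asboolP; exists (a *: y); rewrite linearZ.
split=> [|_ _ /asboolP [y <-] /asboolP [y' <-]]; apply/asboolP.
  by exists 0; rewrite raddf0.
by exists (y + y'); rewrite raddfD.
Qed.
HB.instance Definition _ (A : cpx r) p n :=
  GRing.isSubmodClosed.Build R (A p n) (@is_boundary A p n)
    (@boundary_closed A p n).

Definition cycles (A : cpx r) p n : submodClosed (A p n) :=
  GRing.SubmodClosed.clone R (A p n) (@is_cycle A p n) _.

Definition boundaries (A : cpx r) p n : submodClosed (A p n) :=
  GRing.SubmodClosed.clone R (A p n) (@is_boundary A p n) _.

Definition homology (A : cpx r) : bigraded :=
  fun p n => subquot (cycles A p n) (boundaries A p n).

Lemma cycleP (A : cpx r) p n p' n' (e1 : p' = p - r%:Z)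
    (e2 : n' = n + 1 - r%:Z) (x : A p n) :
  x \in cycles A p n <-> diff A e1 e2 x = 0.
Proof. by subst; rewrite unfold_in; split=> [/eqP|/eqP]. Qed.

Lemma boundaryP (A : cpx r) p n p0 n0 (e1 : p = p0 - r%:Z)
    (e2 : n = n0 + 1 - r%:Z) (x : A p n) :
  x \in boundaries A p n <-> exists y : A p0 n0, diff A e1 e2 y = x.
Proof.
have ep : p0 = p + r%:Z by rewrite e1 subrK.
have en : n0 = n - 1 + r%:Z by rewrite e2 addrAC subrK addrK.
subst p0 n0; rewrite (eq_irrelevance e1 (prev_p p)).
by rewrite (eq_irrelevance e2 (prev_n n)) unfold_in; split=> /asboolP.
Qed.

Fact cpxhom_cycle (A B : cpx r) (f : cpxhom A B) p n :
  {homo f p n : x / x \in cycles A p n >-> x \in cycles B p n}.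
Proof.
move=> x; rewrite !unfold_in -cpx_map_diff => /eqP ->.
by rewrite raddf0.
Qed.

Fact cpxhom_boundary (A B : cpx r) (f : cpxhom A B) p n :
  {homo f p n : x / x \in boundaries A p n >-> x \in boundaries B p n}.
Proof.
move=> x; rewrite !unfold_in => /asboolP [y <-]; apply/asboolP.
by exists (f _ _ y); rewrite cpx_map_diff.
Qed.

Definition homology_map (A B : cpx r) (f : cpxhom A B) :
    bghom (homology A) (homology B) := fun p n =>
  subquot_map (@cpxhom_cycle A B f p n) (@cpxhom_boundary A B f p n).

Fact homology_map_id (A : cpx r) :
  homology_map (cpxid A) = @bgid (homology A).
Proof.
apply: bghom_ext => p n c; rewrite -(subquot_reprK c).
rewrite subquot_mapE; congr subquot_pi; exact: val_inj.
Qed.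

Fact homology_map_comp (A B C : cpx r) (g : cpxhom B C) (f : cpxhom A B) :
  homology_map (cpxcomp g f) = bgcomp (homology_map g) (homology_map f).
Proof.
apply: bghom_ext => p n c; rewrite -(subquot_reprK c) [LHS]subquot_mapE.
transitivity (homology_map g p n (subquot_pi _
    (submod_map (@cpxhom_cycle A B f p n) (repr c)))); last first.
  by congr (homology_map g p n _); rewrite subquot_mapE.
rewrite subquot_mapE; congr subquot_pi; exact: val_inj.
Qed.

Definition Homology : functor CpxCat BgMod :=
  @Functor CpxCat BgMod homology homology_map
    homology_map_id homology_map_comp.

Definition quasi_iso (A B : CpxCat) (f : hom A B) : Prop :=
  is_iso (fmap Homology f).

Definition bgsurjective (A B : CpxCat) (f : hom A B) : Prop :=
  forall p n (y : B p n), exists x : A p n, f p n x = y.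

End CpxCategory.

Arguments Homology {r}.

Definition zero_diff (r : nat) (M : bigraded) : cpx r :=
  @Cpx r M (fun _ _ _ _ _ _ => \0) (fun _ _ _ _ _ _ _ _ _ _ _ => erefl).

Definition zero_diff_map (r : nat) (M N : bigraded) (f : bghom M N) :
  cpxhom (zero_diff r M) (zero_diff r N) :=
  @Cpxhom r (zero_diff r M) (zero_diff r N) f
    (fun _ _ p' n' _ _ _ => raddf0 (f p' n')).

Section ZeroDiffHomology.
Variables (r : nat) (M : bigraded) (p n : int).

Fact zero_diff_cycle (x : M p n) : x \in cycles (zero_diff r M) p n.
Proof. exact: eqxx. Qed.

Definition zero_diff_class (x : M p n) : homology (zero_diff r M) p n :=
  subquot_pi (boundaries (zero_diff r M) p n) (Submod (zero_diff_cycle x)).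

Fact zero_diff_class_linear : linear zero_diff_class.
Proof.
move=> a x y; rewrite -[RHS]linearP; congr subquot_pi; exact: val_inj.
Qed.
HB.instance Definition _ := GRing.isLinear.Build R (M p n)
  (homology (zero_diff r M) p n) _ zero_diff_class zero_diff_class_linear.

End ZeroDiffHomology.

(* The identification of M with H(M, 0). *)
Definition zero_diff_char (r : nat) (M : bigraded) :
    bghom M (homology (zero_diff r M)) :=
  fun p n => @zero_diff_class r M p n.

Section Translation.
Variable r : nat.

Definition transl_mod (M : bigraded) : bigraded := fun p n => M n (2 * n - p).

Fact transl_p (n n' : int) : n' = n + 1 - r.+1%:Z -> n' = n - r%:Z.
Proof. lia. Qed.

Fact transl_n (p n p' n' : int) :
  p' = p - r.+1%:Z -> n' = n + 1 - r.+1%:Z ->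
  2 * n' - p' = 2 * n - p + 1 - r%:Z.
Proof. lia. Qed.

Definition transl (A : cpx r) : cpx r.+1 :=
  @Cpx r.+1 (transl_mod A)
    (fun p n p' n' e1 e2 => diff A (transl_p e2) (transl_n e1 e2))
    (fun _ _ _ _ _ _ e1 e2 e3 e4 x => diff_diff
       (transl_p e2) (transl_n e1 e2) (transl_p e4) (transl_n e3 e4) x).

Definition transl_map (A B : cpx r) (f : cpxhom A B) :
    cpxhom (transl A) (transl B) :=
  @Cpxhom r.+1 (transl A) (transl B) (fun p n => f n (2 * n - p))
    (fun _ _ _ _ e1 e2 x => cpx_map_diff f (transl_p e2) (transl_n e1 e2) x).

Fact transl_map_id (A : cpx r) : transl_map (cpxid A) = cpxid (transl A).
Proof. exact: cpxhom_ext. Qed.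

Fact transl_map_comp (A B C : cpx r) (g : cpxhom B C) (f : cpxhom A B) :
  transl_map (cpxcomp g f) = cpxcomp (transl_map g) (transl_map f).
Proof. exact: cpxhom_ext. Qed.

Definition Transl : functor (CpxCat r) (CpxCat r.+1) :=
  @Functor (CpxCat r) (CpxCat r.+1) transl transl_map
    transl_map_id transl_map_comp.

Variables (A : cpx r) (p n : int).

Fact transl_cycle : {homo (idfun : A n (2 * n - p) -> transl A p n) :
  x / x \in cycles A n (2 * n - p) >-> x \in cycles (transl A) p n}.
Proof.
move=> x cx; apply/eqP; move: cx.
by move/(cycleP (transl_p (erefl (n + 1 - r.+1%:Z)))
  (transl_n (erefl (p - r.+1%:Z)) (erefl (n + 1 - r.+1%:Z)))).
Qed.

Fact transl_boundary : {homo (idfun : A n (2 * n - p) -> transl A p n) :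
  x / x \in boundaries A n (2 * n - p) >-> x \in boundaries (transl A) p n}.
Proof.
have e1 : p = p + r.+1%:Z - r.+1%:Z by lia.
have e2 : n = n + r%:Z + 1 - r.+1%:Z by lia.
move=> x /(boundaryP (transl_p e2) (transl_n e1 e2)) bx.
by apply/(boundaryP (A := transl A) e1 e2).
Qed.

Definition homology_transl :
    {linear homology A n (2 * n - p) -> homology (transl A) p n} :=
  subquot_map transl_cycle transl_boundary.

End Translation.

Record espse := ESpSeq {
  page :> forall i : nat, cpx i;
  char : forall i, bghom (page i.+1) (homology (page i)) }.

Arguments char : clear implicits.

Record espse_hom (X Y : espse) := ESpSeHom {
  page_map :> forall i, cpxhom (X i) (Y i);
  page_map_char : forall i,
    bgcomp (char Y i) (page_map i.+1) =
    bgcomp (homology_map (page_map i)) (char X i) }.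

Lemma espse_hom_ext (X Y : espse) (f g : espse_hom X Y) :
  (forall i p n, f i p n =1 g i p n) -> f = g.
Proof.
case: f g => f cf [g cg] /= fg.
have {}fg : f = g.
  apply: functional_extensionality_dep => i; apply: cpxhom_ext => p n.
  exact: fg.
by rewrite -fg in cg *; rewrite (Prop_irrelevance cf cg).
Qed.

Fact espse_id_char (X : espse) i :
  bgcomp (char X i) (cpxid (X i.+1)) =
  bgcomp (homology_map (cpxid (X i))) (char X i).
Proof. by rewrite homology_map_id bgcomp1m; exact: bgcompm1. Qed.

Definition espse_id (X : espse) : espse_hom X X :=
  ESpSeHom (@espse_id_char X).

Fact espse_comp_char (X Y Z : espse) (g : espse_hom Y Z) (f : espse_hom X Y) i :
  bgcomp (char Z i) (cpxcomp (g i.+1) (f i.+1)) =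
  bgcomp (homology_map (cpxcomp (g i) (f i))) (char X i).
Proof.
rewrite homology_map_comp -bgcompA -page_map_char bgcompA -page_map_char.
by rewrite -bgcompA.
Qed.

Definition espse_comp (X Y Z : espse)
    (g : espse_hom Y Z) (f : espse_hom X Y) : espse_hom X Z :=
  ESpSeHom (espse_comp_char g f).

Fact espse_compA (X Y Z W : espse)
    (h : espse_hom Z W) (g : espse_hom Y Z) (f : espse_hom X Y) :
  espse_comp h (espse_comp g f) = espse_comp (espse_comp h g) f.
Proof. exact: espse_hom_ext. Qed.

Fact espse_comp1m (X Y : espse) (f : espse_hom X Y) :
  espse_comp (espse_id Y) f = f.
Proof. exact: espse_hom_ext. Qed.

Fact espse_compm1 (X Y : espse) (f : espse_hom X Y) :
  espse_comp f (espse_id X) = f.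
Proof. exact: espse_hom_ext. Qed.

Definition ESpSe : category := Category espse_compA espse_comp1m espse_compm1.

(* A model structure is determined by its fibrations and weak equivalences, the
   cofibrations being the maps with the left lifting property against the
   trivial fibrations. *)
Definition is_ESpSe' (r : nat) (M : model_structure ESpSe) : Prop :=
  (forall (X Y : ESpSe) (f : hom X Y),
     fib M f <-> forall i, (i <= r)%N -> bgsurjective (f i)) /\
  (forall (X Y : ESpSe) (f : hom X Y),
     weq M f <-> @quasi_iso r (X r) (Y r) (f r) /\
       forall i, (r < i)%N -> @is_iso (CpxCat i) (X i) (Y i) (f i)).

Definition shift_page (X : espse) (i : nat) : cpx i :=
  match i with
  | 0 => zero_diff 0 (transl (X 0%N))
  | j.+1 => transl (X j)
  end.

(* In degree j.+2 the characteristic map is the translate of that of X,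
   followed by the identification of T (H A) with H (T A). *)
Definition shift_char (X : espse) (i : nat) :
    bghom (shift_page X i.+1) (homology (shift_page X i)) :=
  match i with
  | 0 => zero_diff_char 0 (transl (X 0%N))
  | j.+1 => fun p n => homology_transl (X j) p n \o char X j n (2 * n - p)
  end.

Definition shift (X : espse) : espse := ESpSeq (shift_char X).

Definition shift_page_map (X Y : espse) (f : espse_hom X Y) (i : nat) :
    cpxhom (shift X i) (shift Y i) :=
  match i with
  | 0 => zero_diff_map 0 (transl_map (f 0%N))
  | j.+1 => transl_map (f j)
  end.

Fact homology_transl_map r (A B : cpx r) (f : cpxhom A B) p n
    (c : homology A n (2 * n - p)) :
  homology_transl B p n (homology_map f n (2 * n - p) c) =
  homology_map (transl_map f) p n (homology_transl A p n c).
Proof.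
rewrite -(subquot_reprK c); set x := repr c.
transitivity (homology_transl B p n (subquot_pi _
    (submod_map (@cpxhom_cycle r A B f n (2 * n - p)) x))).
  by congr (homology_transl B p n _); rewrite subquot_mapE.
transitivity (homology_map (transl_map f) p n (subquot_pi _
    (submod_map (@transl_cycle r A p n) x))); last first.
  by congr (homology_map (transl_map f) p n _); rewrite subquot_mapE.
rewrite [LHS]subquot_mapE [RHS]subquot_mapE; congr subquot_pi; exact: val_inj.
Qed.

Fact shift_map_char (X Y : espse) (f : espse_hom X Y) i :
  bgcomp (char (shift Y) i) (shift_page_map f i.+1) =
  bgcomp (homology_map (shift_page_map f i)) (char (shift X) i).
Proof.
case: i => [|j]; apply: bghom_ext => p n x.
  apply/esym; apply: (etrans (subquot_mapE
    (@cpxhom_cycle 0 _ _ (shift_page_map f 0) p n)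
    (@cpxhom_boundary 0 _ _ (shift_page_map f 0) p n)
    (Submod (@zero_diff_cycle 0 (transl (X 0%N)) p n x)))).
  apply: (congr1 (subquot_pi _)); exact: val_inj.
apply: etrans (homology_transl_map (f j) (char X j n (2 * n - p) x)).
congr (homology_transl (Y j) p n _).
have /(congr1 (fun h : bghom _ _ => h n (2 * n - p) x)) := page_map_char f j.
exact.
Qed.

Definition shift_map (X Y : espse) (f : espse_hom X Y) :
  espse_hom (shift X) (shift Y) := ESpSeHom (shift_map_char f).

Fact shift_map_id (X : espse) : shift_map (espse_id X) = espse_id (shift X).
Proof. by apply: espse_hom_ext => -[|j]. Qed.

Fact shift_map_comp (X Y Z : espse)
    (g : espse_hom Y Z) (f : espse_hom X Y) :
  shift_map (espse_comp g f) = espse_comp (shift_map g) (shift_map f).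
Proof. by apply: espse_hom_ext => -[|j]. Qed.

Definition Shift : functor ESpSe ESpSe :=
  @Functor ESpSe ESpSe shift shift_map shift_map_id shift_map_comp.

End Bigraded.

Arguments diff {R r} A {p n p' n'} e1 e2 : rename.
Arguments char {R} X i : rename.

(* Main.v *)
From HB Require Import structures.
From mathcomp Require Import all_boot all_order all_algebra.
From mathcomp Require Import boolp zify.
Require Import Defs.

(** Write F for the functor Shift. It is fully faithful, and since page i + 1 of
    F X is the translate of page i of X, it preserves and reflects weak
    equivalences and preserves fibrations. Both Quillen equivalences are then
    formal consequences of one concrete fact: F has a right adjoint whose counit
    is always a weak equivalence and which preserves fibrations.

    The concrete fact. [dec X] is the decalage of X and [counit X] the universal
    arrow from F to X ([dec_trK], [counit_inj]). On pages i >= 2 the counit is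
    an isomorphism; on page 1 it is the projection [rho] from the complex of
    witnesses to X 1, a quasi-isomorphism because every element of X 1 has a
    characteristic class, hence a representative on page 0
    ([rho_quasi_iso]). Decalage preserves fibrations because representatives
    lift along maps that are surjective on page 0 ([lift_class]).

    Shift -| Dec. Two out of three for the counit shows that the decalage also
    preserves weak equivalences, so it preserves fibrations and trivial
    fibrations, and F is left Quillen. The transpose g of f : F X -> Y
    satisfies f = counit o F g, so f is a weak equivalence exactly when F g is,
    that is, exactly when g is. An arbitrary right adjoint of F has a counit
    that is a retract of this one ([left_adjoint_equivalence]).

    LDec -| Shift. F preserves fibrations and trivial fibrations, so LDec is
    left Quillen, and everything reduces to showing that the unit eta at a
    cofibrant X is a weak equivalence ([eta_cofibrant_weq]). Factor the counit
    F Z -> X, where Z = dec X, as a trivial cofibration F Z -> E followed by a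
    fibration E -> X, which is then trivial. The unit is an isomorphism at F Z
    by full faithfulness, hence a weak equivalence at E because LDec preserves
    trivial cofibrations. As X is cofibrant, E -> X has a section, so the unit
    at X is a retract of the unit at E. *)

Set Implicit Arguments.
Unset Strict Implicit.
Unset Printing Implicit Defensive.

Import GRing.Theory.
Local Open Scope ring_scope.

(** * Adjunctions and model structures *)

Section Lifting.
Variables (C : category) (M : model_structure C).

(** The retract argument: a lift of the identity along p exhibits f as a
    retract of i. *)
Lemma llp_retract (A B E : C) (f : hom A B) (i : hom A E) (p : hom E B) :
  p \oc i = f -> has_lift f p -> is_retract f i.
Proof.
move=> pif lfp; have [|h [hf ph]] := lfp i (idm B); first by rewrite mcomp1m.
by exists (idm A), h, (idm A), p; split; rewrite ?mcomp1m ?mcompm1.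
Qed.

Lemma cof_of_llp (A B : C) (f : hom A B) :
  (forall (X Y : C) (p : hom X Y), fib M p -> weq M p -> has_lift f p) ->
  cof M f.
Proof.
move=> lf; have [E [i [p [ci fp wp pif]]]] := cof_tfib_factor M f.
exact: cof_retract (llp_retract pif (lf _ _ _ fp wp)) ci.
Qed.

Lemma tcof_of_llp (A B : C) (f : hom A B) :
  (forall (X Y : C) (p : hom X Y), fib M p -> has_lift f p) ->
  cof M f /\ weq M f.
Proof.
move=> lf; have [E [i [p [ci wi fp pif]]]] := tcof_fib_factor M f.
have rfi := llp_retract pif (lf _ _ _ fp).
by split; [exact: cof_retract rfi ci | exact: weq_retract rfi wi].
Qed.

End Lifting.

Lemma is_iso_fmap (C D : category) (F : functor C D) (A B : C) (f : hom A B) :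
  is_iso f -> is_iso (fmap F f).
Proof.
by move=> [g [gf fg]]; exists (fmap F g); rewrite -!fmap_comp gf fg !fmap_id.
Qed.

Lemma iso_comp (C : category) (X Y Z : C) (g : hom Y Z) (f : hom X Y) :
  is_iso f -> is_iso g -> is_iso (g \oc f).
Proof.
move=> [f' [ff' f'f]] [g' [gg' g'g]]; exists (f' \oc g').
split; first by rewrite -mcompA (mcompA g') gg' mcomp1m.
by rewrite -mcompA (mcompA f) f'f mcomp1m.
Qed.

Section Adjunction.
Variables (C D : category) (F : functor C D) (G : functor D C).
Variable a : adjunction F G.

Lemma adj_inj X Y : injective (@adj C D F G a X Y).
Proof. exact: bij_inj (adj_bij a X Y). Qed.

Lemma adj_surj X Y (g : hom X (G Y)) : exists f : hom (F X) Y, adj a f = g.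
Proof. by have [h _ hK] := adj_bij a X Y; exists (h g). Qed.

Lemma adj_lift (A B : C) (X Y : D) (f : hom A B) (p : hom X Y) :
  has_lift f (fmap G p) -> has_lift (fmap F f) p.
Proof.
move=> lf u v puv; have [|h [hf ph]] := lf (adj a u) (adj a v).
  by rewrite -adj_natr puv adj_natl.
have [k kh] := adj_surj h; exists k.
by split; apply: adj_inj; rewrite ?adj_natl ?adj_natr kh.
Qed.

(** The left Quillen condition is a lifting property of the images under F,
    which transposes to a lifting property against the images under G. *)
Lemma left_quillen_of_right (M : model_structure C) (N : model_structure D) :
  (forall (X Y : D) (p : hom X Y), fib N p -> fib M (fmap G p)) ->
  (forall (X Y : D) (p : hom X Y), fib N p -> weq N p -> weq M (fmap G p)) ->
  left_quillen M N F.
Proof.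
move=> Gf Gw; split=> A B f cf => [|wf].
  apply: cof_of_llp => X Y p fp wp; apply: adj_lift.
  by apply: cof_lift cf _ _; [exact: Gf | exact: Gw].
apply: tcof_of_llp => X Y p fp; apply: adj_lift.
by apply: tcof_lift cf wf _; exact: Gf.
Qed.

Lemma adj_unit X Y (f : hom (F X) Y) :
  adj a f = fmap G f \oc adj a (idm (F X)).
Proof. by rewrite -adj_natr mcompm1. Qed.

Lemma counit_adj X Y (e : hom (F (G Y)) Y) (f : hom (F X) Y) :
  adj a e = idm (G Y) -> e \oc fmap F (adj a f) = f.
Proof. by move=> ae; apply: adj_inj; rewrite adj_natl ae mcomp1m. Qed.

End Adjunction.

Section UniversalArrows.
Variables (C D : category) (F : functor C D) (G0 : D -> C).
Variable eps : forall Y, hom (F (G0 Y)) Y.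
Variable tr : forall X Y, hom (F X) Y -> hom X (G0 Y).
Hypothesis epsK : forall X Y (f : hom (F X) Y), eps Y \oc fmap F (tr f) = f.
Hypothesis eps_inj : forall X Y (g h : hom X (G0 Y)),
  eps Y \oc fmap F g = eps Y \oc fmap F h -> g = h.

Let gmap (Y Y' : D) (v : hom Y Y') : hom (G0 Y) (G0 Y') := tr (v \oc eps Y).

Fact univ_id Y : gmap (idm Y) = idm (G0 Y).
Proof. by apply: eps_inj; rewrite epsK fmap_id mcomp1m mcompm1. Qed.

Fact univ_comp Y Y' Y'' (w : hom Y' Y'') (v : hom Y Y') :
  gmap (w \oc v) = gmap w \oc gmap v.
Proof. by apply: eps_inj; rewrite fmap_comp mcompA !epsK -!mcompA epsK. Qed.

Definition univ_functor : functor D C := Functor univ_id univ_comp.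

Fact univ_bij X Y : bijective (@tr X Y).
Proof.
exists (fun g => eps Y \oc fmap F g) => [f|g]; first exact: epsK.
by apply: eps_inj; rewrite epsK.
Qed.

Fact univ_natl X X' Y (u : hom X' X) (f : hom (F X) Y) :
  tr (f \oc fmap F u) = tr f \oc u.
Proof. by apply: eps_inj; rewrite fmap_comp mcompA !epsK. Qed.

Fact univ_natr X Y Y' (v : hom Y Y') (f : hom (F X) Y) :
  tr (v \oc f) = gmap v \oc tr f.
Proof. by apply: eps_inj; rewrite fmap_comp mcompA !epsK -mcompA epsK. Qed.

Definition univ_adjunction : adjunction F univ_functor :=
  @Adjunction C D F univ_functor tr univ_bij univ_natl univ_natr.

End UniversalArrows.

Section QuillenEquivalences.
Variables (C D : category) (M : model_structure C) (N : model_structure D).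
Variables (F : functor C D) (G : functor D C) (b : adjunction F G).
Hypothesis weqF : forall (X Y : C) (f : hom X Y), weq M f <-> weq N (fmap F f).
Hypothesis counit_weq :
  forall (Y : D) (e : hom (F (G Y)) Y), adj b e = idm (G Y) -> weq N e.
Hypothesis fibG :
  forall (X Y : D) (p : hom X Y), fib N p -> fib M (fmap G p).

(** Naturality of the counit puts F G p and p in a square whose other two sides
    are weak equivalences. *)
Lemma weq_right_adjoint (X Y : D) (p : hom X Y) :
  weq N p -> weq M (fmap G p).
Proof.
move=> wp; apply/weqF; have [eX eXE] := adj_surj b (idm (G X)).
have [eY eYE] := adj_surj b (idm (G Y)).
apply: (weq_cancell (counit_weq eYE)).
have -> : eY \oc fmap F (fmap G p) = p \oc eX.
  apply: (adj_inj (a := b)).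
  by rewrite adj_natl adj_natr eXE eYE mcomp1m mcompm1.
exact: weq_comp (counit_weq eXE) wp.
Qed.

Lemma left_adjoint_quillen : left_quillen M N F.
Proof.
apply: (left_quillen_of_right b) => // X Y p _; exact: weq_right_adjoint.
Qed.

(** The counit of any right adjoint G' of F is a weak equivalence, because the
    comparison G' Y -> G Y makes it a retract of the counit for G. *)
Lemma left_adjoint_equivalence (G' : functor D C) (a : adjunction F G') :
  quillen_equivalence M N a.
Proof.
split=> [|X Y f _ _]; first exact: left_adjoint_quillen.
have [e eE] := adj_surj a (idm (G' Y)).
have [e' e'E] := adj_surj b (idm (G Y)).
have we : weq N e.
  apply: weq_retract (counit_weq e'E).
  exists (fmap F (adj b e)), (idm Y), (fmap F (adj a e')), (idm Y).
  rewrite !mcomp1m (counit_adj _ eE) (counit_adj _ e'E) -fmap_comp.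
  split=> //; rewrite -(fmap_id F); congr (fmap F _).
  by rewrite -adj_natl (counit_adj _ e'E).
rewrite weqF -{1}(counit_adj f eE); split=> [|wf]; first exact: weq_cancell.
exact: weq_comp wf we.
Qed.

Hypothesis fibF :
  forall (X Y : C) (p : hom X Y), fib M p -> fib N (fmap F p).
Hypothesis fmap_inj : forall X Y (f g : hom X Y), fmap F f = fmap F g -> f = g.
Hypothesis fmap_full : forall X Y (g : hom (F X) (F Y)),
  exists f : hom X Y, fmap F f = g.
Hypothesis weq_iso : forall (X Y : C) (f : hom X Y), is_iso f -> weq M f.
Variable I : D.
Hypothesis initI : is_initial I.

Section LeftAdjoint.
Variables (L : functor D C) (a : adjunction L F).
Let eta (X : D) : hom X (F (L X)) := adj a (idm (L X)).

Lemma right_adjoint_quillen : left_quillen N M L.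
Proof.
by apply: (left_quillen_of_right a) => // X Y p _; move/weqF.
Qed.

Lemma eta_nat (X Y : D) (f : hom X Y) :
  eta Y \oc f = fmap F (fmap L f) \oc eta X.
Proof. by rewrite /eta -adj_natl -adj_natr mcomp1m mcompm1. Qed.

(** Fullness gives eta (F Z) = F k; the triangle identity and faithfulness make
    k inverse to the counit L (F Z) -> Z. *)
Lemma eta_image_weq (Z : C) : weq N (eta (F Z)).
Proof.
have [k kE] := fmap_full (eta (F Z)).
have [c cE] := adj_surj a (idm (F Z)).
rewrite -kE -weqF; apply: weq_iso; exists c.
have Fce : fmap F c \oc eta (F Z) = idm (F Z) by rewrite -adj_unit.
split.
  by apply: fmap_inj; rewrite fmap_comp fmap_id kE.
apply: (adj_inj (a := a)); rewrite adj_unit fmap_comp -mcompA Fce mcompm1.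
exact: kE.
Qed.

(** The unit is a weak equivalence at F (G X), and X is a retract of an object E
    that receives a trivial cofibration from F (G X). *)
Lemma eta_cofibrant_weq (X : D) : cofibrant N X -> weq N (eta X).
Proof.
move=> cX; have [e eE] := adj_surj b (idm (G X)).
have [E [j [q [cj wj fq qje]]]] := tcof_fib_factor N e.
have wq : weq N q.
  by apply: (weq_cancelr wj); rewrite qje; exact: counit_weq eE.
have wE : weq N (eta E).
  apply: (weq_cancelr wj); rewrite eta_nat.
  apply: weq_comp (eta_image_weq _) _.
  by rewrite -weqF; exact: (right_adjoint_quillen.2 _ _ _ cj wj).2.
(* The section of q lifts the identity along the cofibration from the initial
   object. *)
have [i _] := initI X; have [z _] := initI E.
have qz : q \oc z = idm X \oc i.
  by have [k [_ k1]] := initI X; rewrite -(k1 (q \oc z)) // -(k1 (_ \oc i)).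
have [s [_ qs]] := cof_lift (cX _ i initI) fq wq qz.
apply: weq_retract wE.
exists s, (fmap F (fmap L s)), q, (fmap F (fmap L q)).
by rewrite -!fmap_comp qs !fmap_id; split; rewrite ?eta_nat.
Qed.

Lemma right_adjoint_equivalence : quillen_equivalence N M a.
Proof.
split=> [|X Y f cX _]; first exact: right_adjoint_quillen.
have we := eta_cofibrant_weq cX.
rewrite weqF adj_unit; split=> [wf|]; first exact: weq_comp we wf.
exact: weq_cancelr.
Qed.

End LeftAdjoint.
End QuillenEquivalences.

(** * Homology classes and their representatives *)

Section Classes.
Variable R : comPzRingType.
Implicit Types (r : nat) (p n : int).

(** The relation between a homology class and its representatives. Statements on
    characteristic maps are phrased with it, which replaces computations with
    induced maps on quotients by choices of representatives. *)
Definition in_class r (A : cpx R r) p n (c : homology A p n) (x : A p n) :=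
  exists zx : x \in cycles A p n,
    c = subquot_pi (boundaries A p n) (Submod zx).

Lemma in_class_ex r (A : cpx R r) p n (c : homology A p n) :
  exists x, in_class c x.
Proof.
exists (submod_val (repr c)), (valP (repr c)); rewrite -[LHS]subquot_reprK.
by congr subquot_pi; exact: val_inj.
Qed.

Lemma cycle_in_class r (A : cpx R r) p n (x : A p n) :
  x \in cycles A p n -> exists c : homology A p n, in_class c x.
Proof. by move=> zx; exists (subquot_pi _ (Submod zx)), zx. Qed.

Lemma in_class_cycle r (A : cpx R r) p n (c : homology A p n) x :
  in_class c x -> x \in cycles A p n.
Proof. by case. Qed.

Lemma in_class_eq r (A : cpx R r) p n (c c' : homology A p n) x x' :
  in_class c x -> in_class c' x' -> c = c' <-> x - x' \in boundaries A p n.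
Proof. by move=> [zx ->] [zx' ->]; exact: subquot_piP. Qed.

Lemma in_class_inj r (A : cpx R r) p n (c c' : homology A p n) x :
  in_class c x -> in_class c' x -> c = c'.
Proof. by move=> cx c'x; apply/(in_class_eq cx c'x); rewrite subrr rpred0. Qed.

Lemma in_class_sub r (A : cpx R r) p n (c : homology A p n) x y :
  in_class c x -> y - x \in boundaries A p n -> in_class c y.
Proof.
move=> [zx cE] bxy; have zxy : y - x \in cycles A p n.
  case/(boundaryP (prev_p r p) (prev_n r n)): bxy => w <-.
  by apply/(cycleP erefl erefl); exact: diff_diff.
have zy : y \in cycles A p n by rewrite -[y](subrK x) rpredD.
by exists zy; rewrite cE; apply/subquot_piP; rewrite -opprB rpredN.
Qed.

Lemma in_class_linear r (A : cpx R r) p n (a : R) (c c' : homology A p n) x x' :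
  in_class c x -> in_class c' x' -> in_class (a *: c + c') (a *: x + x').
Proof.
move=> [zx ->] [zx' ->].
have z : a *: x + x' \in cycles A p n by rewrite rpredD // rpredZ.
by exists z; rewrite -linearP; congr subquot_pi; exact: val_inj.
Qed.

Lemma in_class0 r (A : cpx R r) p n : in_class (0 : homology A p n) 0.
Proof.
have z0 : 0 \in cycles A p n by exact: rpred0.
exists z0; rewrite -(linear0 (@subquot_pi _ _ _ (boundaries A p n))).
by congr subquot_pi; exact: val_inj.
Qed.

Lemma in_class_map r (A B : cpx R r) (f : cpxhom A B) p n c x :
  in_class c x -> in_class (homology_map f p n c) (f p n x).
Proof.
move=> [zx ->]; rewrite subquot_mapE.
by exists (cpxhom_cycle f zx); congr subquot_pi; exact: val_inj.
Qed.

Lemma in_class_transl r (A : cpx R r) p n (c : homology A n (2 * n - p)) x :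
  in_class c x -> in_class (homology_transl A p n c) x.
Proof.
move=> [zx ->]; rewrite subquot_mapE.
by exists (transl_cycle zx); congr subquot_pi; exact: val_inj.
Qed.

Lemma in_class_zero_diff r (M : bigraded R) p n (x : M p n) :
  in_class (zero_diff_char r M p n x) x.
Proof. by exists (zero_diff_cycle r x). Qed.

Lemma in_class_zero_diff_inj r (M : bigraded R) p n
    (c : homology (zero_diff r M) p n) x x' :
  in_class c x -> in_class c x' -> x = x'.
Proof.
move=> cx cx'; have /(in_class_eq cx cx') := erefl c.
case/(boundaryP (prev_p r p) (prev_n r n)) => y.
by move/esym/eqP; rewrite subr_eq0 => /eqP.
Qed.

Lemma char_map_in_class (X Y : espse R) (f : espse_hom X Y) i p n x z :
  in_class (char X i p n x) z ->
  in_class (char Y i p n (f i.+1 p n x)) (f i p n z).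
Proof.
have /(congr1 (fun h : bghom _ _ => h p n x)) := page_map_char f i.
by move=> /= -> /(in_class_map (f i)).
Qed.

(** Compatibility with the characteristic maps, tested on representatives; this
    is how every morphism of extended spectral sequences is built below. *)
Lemma char_map_of_class (X Y : espse R) (f : forall i, cpxhom (X i) (Y i)) :
  (forall i p n x z, in_class (char X i p n x) z ->
     in_class (char Y i p n (f i.+1 p n x)) (f i p n z)) ->
  forall i, bgcomp (char Y i) (f i.+1) =
            bgcomp (homology_map (f i)) (char X i).
Proof.
move=> fc i; apply: bghom_ext => p n x /=.
have [z xz] := in_class_ex (char X i p n x).
exact: in_class_inj (fc _ _ _ _ _ xz) (in_class_map (f i) xz).
Qed.

Lemma bij_inj_surj (T U : Type) (f : T -> U) :
  bijective f <-> injective f /\ forall y, exists x, f x = y.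
Proof.
split=> [[g fK gK]|[fi fs]].
  by split; [exact: can_inj fK | move=> y; exists (g y)].
have [g gP] := choice fs; exists g => // x; exact: fi.
Qed.

Lemma linear_inv (U V : lmodType R) (f : {linear U -> V}) :
  bijective f -> exists g : {linear V -> U}, cancel f g /\ cancel g f.
Proof.
case=> g fK gK.
have gl : linear g by move=> a x y; rewrite -{1}[x]gK -{1}[y]gK -linearP fK.
by exists (HB.pack_for {linear V -> U} g (GRing.isLinear.Build R V U _ g gl)).
Qed.

Lemma bgiso_bij (A B : bigraded R) (h : bghom A B) :
  @is_iso (BgMod R) A B h <-> forall p n, bijective (h p n).
Proof.
split=> [[g [gh hg]] p n|hb].
  exists (g p n) => x.
    exact: (congr1 (fun k : bghom A A => k p n x) gh).
  exact: (congr1 (fun k : bghom B B => k p n x) hg).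
pose g p n := cid (linear_inv (hb p n)); exists (fun p n => projT1 (g p n)).
by split; apply: bghom_ext => p n x /=; case: (g p n) => k [].
Qed.

Lemma cpxiso_bij r (A B : cpx R r) (f : cpxhom A B) :
  @is_iso (CpxCat R r) A B f <-> forall p n, bijective (f p n).
Proof.
split=> [[g [gf fg]] p n|fb].
  exists (g p n) => x.
    exact: (congr1 (fun k : cpxhom A A => k p n x) gf).
  exact: (congr1 (fun k : cpxhom B B => k p n x) fg).
have [g [gf fg]] := (bgiso_bij f).2 fb.
have fK p n : cancel (f p n) (g p n).
  by move=> x; exact: (congr1 (fun k : bghom A A => k p n x) gf).
have gK p n : cancel (g p n) (f p n).
  by move=> x; exact: (congr1 (fun k : bghom B B => k p n x) fg).
have gd p n p' n' (e1 : p' = p - r%:Z) (e2 : n' = n + 1 - r%:Z) (y : B p n) :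
    g p' n' (diff B e1 e2 y) = diff A e1 e2 (g p n y).
  by rewrite -{1}[y](gK p n) -cpx_map_diff fK.
by exists (Cpxhom gd); split; apply: cpxhom_ext.
Qed.

Lemma quasi_isoP r (A B : cpx R r) (f : cpxhom A B) :
  quasi_iso f <->
  (forall p n x, x \in cycles A p n -> f p n x \in boundaries B p n ->
     x \in boundaries A p n) /\
  (forall p n y, y \in cycles B p n ->
     exists2 x, x \in cycles A p n & y - f p n x \in boundaries B p n).
Proof.
apply: (iff_trans (bgiso_bij (homology_map f))).
split=> [fb|[fi fs] p n].
  split=> p n x zx; have /bij_inj_surj [fi fs] := fb p n.
    have [c cx] := cycle_in_class zx => bfx.
    have c0 := in_class0 A p n; have fc0 := in_class0 B p n.
    have := (in_class_eq cx c0).1; rewrite subr0; apply.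
    apply: fi; rewrite linear0.
    by apply/(in_class_eq (in_class_map f cx) fc0); rewrite subr0.
  have [c cx] := cycle_in_class zx.
  have [c' fc'] := fs c; have [y c'y] := in_class_ex c'.
  exists y; first exact: in_class_cycle c'y.
  have := in_class_map f c'y; rewrite fc' => cfy.
  exact: (in_class_eq cx cfy).1.
apply/bij_inj_surj; split=> [c c'|c].
  have [x cx] := in_class_ex c; have [x' c'x'] := in_class_ex c'.
  move/(in_class_eq (in_class_map f cx) (in_class_map f c'x')).
  rewrite -linearB => bf; apply/(in_class_eq cx c'x'); apply: fi bf.
  by rewrite rpredB // (in_class_cycle cx, in_class_cycle c'x').
have [y cy] := in_class_ex c.
have [x zx bx] := fs _ _ _ (in_class_cycle cy).
have [c' c'x] := cycle_in_class zx; exists c'.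
by apply/esym/(in_class_eq cy (in_class_map f c'x)).
Qed.

End Classes.

(** * Translation of bigraded complexes *)

Section Cast.
Variable R : comPzRingType.
Implicit Types (r : nat) (p n : int).

(** The translate of an untranslated module equals the original only up to the
    provable equality 2 n - (2 n - p) = p of degrees, whence these transports.
    They commute with all the structure ([map_cast], [diff_cast], [cast_diff],
    [in_class_char_cast]). *)
Definition cast (A : bigraded R) p n p' n' (ep : p = p') (en : n = n') :
    {linear A p n -> A p' n'} :=
  match ep in _ = q, en in _ = m return {linear A p n -> A q m} with
  | erefl, erefl => idfun
  end.

Arguments cast : simpl never.

Lemma cast_id (A : bigraded R) p n (ep : p = p) (en : n = n) (x : A p n) :
  cast A ep en x = x.
Proof. by rewrite (eq_irrelevance ep erefl) (eq_irrelevance en erefl). Qed.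

Lemma map_cast (A B : bigraded R) (f : bghom A B) p n p' n'
    (ep : p = p') (en : n = n') (x : A p n) :
  f p' n' (cast A ep en x) = cast B ep en (f p n x).
Proof. by case: p' / ep; case: n' / en. Qed.

Lemma cast_bij (A : bigraded R) p n p' n' (ep : p = p') (en : n = n') :
  bijective (cast A ep en).
Proof. by case: p' / ep; case: n' / en; exists idfun. Qed.

Lemma castK (A : bigraded R) p n p' n' (ep : p = p') (en : n = n')
    (ep' : p' = p) (en' : n' = n) (x : A p n) :
  cast A ep' en' (cast A ep en x) = x.
Proof. by case: p' / ep ep'; case: n' / en en' => *; rewrite !cast_id. Qed.

Lemma diff_cast r (A : cpx R r) p n p' n' p1 n1
    (ep : p = p') (en : n = n') (e1 : p1 = p' - r%:Z) (e2 : n1 = n' + 1 - r%:Z)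
    (e1' : p1 = p - r%:Z) (e2' : n1 = n + 1 - r%:Z) (x : A p n) :
  diff A e1 e2 (cast A ep en x) = diff A e1' e2' x.
Proof.
case: p' / ep e1 => e1; case: n' / en e2 => e2.
by rewrite (eq_irrelevance e1 e1') (eq_irrelevance e2 e2').
Qed.

Lemma cast_diff r (A : cpx R r) p n p' n' p1 n1
    (ep : p = p') (en : n = n') (e1 : p = p1 - r%:Z) (e2 : n = n1 + 1 - r%:Z)
    (e1' : p' = p1 - r%:Z) (e2' : n' = n1 + 1 - r%:Z) (x : A p1 n1) :
  cast A ep en (diff A e1 e2 x) = diff A e1' e2' x.
Proof.
case: p' / ep e1' => e1'; case: n' / en e2' => e2'.
by rewrite (eq_irrelevance e1 e1') (eq_irrelevance e2 e2').
Qed.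

Lemma in_class_char_cast (X : espse R) i p n p' n'
    (ep : p = p') (en : n = n') (x : X i.+1 p n) (z : X i p n) :
  in_class (char X i p n x) z ->
  in_class (char X i p' n' (cast _ ep en x)) (cast _ ep en z).
Proof. by case: p' / ep; case: n' / en. Qed.

Fact transl_pK p n : 2 * n - (2 * n - p) = p.
Proof. lia. Qed.

(** Every bidegree is a translated one; this reduces a claim on the components
    of a complex to the components visible in its translate. *)
Lemma transl_bideg (P : int -> int -> Prop) :
  (forall p n, P n (2 * n - p)) -> forall p n, P p n.
Proof. by move=> Pt p n; rewrite -(transl_pK n p). Qed.

Section Translation.
Variable r : nat.

Lemma transl_cycles (A : cpx R r) p n (x : transl A p n) :
  x \in cycles (transl A) p n <->
  (x : A n (2 * n - p)) \in cycles A n (2 * n - p).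
Proof.
rewrite (cycleP (A := transl A) erefl erefl).
by rewrite (cycleP (A := A) (transl_p (erefl (n + 1 - r.+1%:Z)))
  (transl_n (erefl (p - r.+1%:Z)) (erefl (n + 1 - r.+1%:Z)))).
Qed.

Lemma transl_boundaries (A : cpx R r) p n (x : transl A p n) :
  x \in boundaries (transl A) p n <->
  (x : A n (2 * n - p)) \in boundaries A n (2 * n - p).
Proof.
have e1 : p = p + r.+1%:Z - r.+1%:Z by lia.
have e2 : n = n + r%:Z + 1 - r.+1%:Z by lia.
rewrite (boundaryP (A := transl A) e1 e2).
by rewrite (boundaryP (A := A) (transl_p e2) (transl_n e1 e2)).
Qed.

Lemma quasi_iso_transl (A B : cpx R r) (f : cpxhom A B) :
  quasi_iso (transl_map f) <-> quasi_iso f.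
Proof.
rewrite !quasi_isoP; split=> -[fi fs]; split.
- apply: transl_bideg => p n x zx bfx; apply/transl_boundaries/fi.
    exact/transl_cycles.
  exact/transl_boundaries.
- apply: transl_bideg => p n y zy.
  have [x zx bx] := fs p n y ((transl_cycles y).2 zy).
  by exists x; [apply/transl_cycles | apply/transl_boundaries].
- move=> p n x zx bfx; apply/transl_boundaries/fi.
    exact/transl_cycles.
  exact/transl_boundaries.
move=> p n y zy; have [x zx bx] := fs _ _ y ((transl_cycles y).1 zy).
by exists x; [apply/transl_cycles | apply/transl_boundaries].
Qed.

Lemma iso_transl (A B : cpx R r) (f : cpxhom A B) :
  @is_iso (CpxCat R r.+1) _ _ (transl_map f) <-> @is_iso (CpxCat R r) _ _ f.
Proof.
rewrite !cpxiso_bij; split=> fb; last by move=> p n; exact: fb.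
by apply: transl_bideg => p n; exact: fb.
Qed.

Lemma surj_transl (A B : cpx R r) (f : cpxhom A B) :
  bgsurjective f -> bgsurjective (transl_map f).
Proof. by move=> fs p n y; exact: fs. Qed.

Lemma in_class_transl_inv (A : cpx R r) p n
    (c : homology A n (2 * n - p)) (x : transl A p n) :
  in_class (homology_transl A p n c) x ->
  in_class c (x : A n (2 * n - p)).
Proof.
have [y cy] := in_class_ex c => cx.
have := (in_class_eq cx (in_class_transl cy)).1 erefl.
by move/transl_boundaries; exact: in_class_sub.
Qed.

Fact untransl_p p p' n n' :
  p' = p - r%:Z -> n' = n + 1 - r%:Z -> 2 * p' - n' = 2 * p - n - r.+1%:Z.
Proof. lia. Qed.

Fact untransl_n p p' : p' = p - r%:Z -> p' = p + 1 - r.+1%:Z.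
Proof. lia. Qed.

Definition untransl (B : cpx R r.+1) : cpx R r :=
  @Cpx R r (fun p n => B (2 * p - n) p)
    (fun p n p' n' e1 e2 => diff B (untransl_p e1 e2) (untransl_n e1))
    (fun _ _ _ _ _ _ e1 e2 e3 e4 x => diff_diff
       (untransl_p e1 e2) (untransl_n e1) (untransl_p e3 e4) (untransl_n e3) x).

Lemma untransl_cycles (B : cpx R r.+1) p n (x : untransl B p n) :
  x \in cycles (untransl B) p n <->
  (x : B (2 * p - n) p) \in cycles B (2 * p - n) p.
Proof.
rewrite (cycleP (A := untransl B) erefl erefl).
by rewrite (cycleP (A := B)
  (untransl_p (erefl (p - r%:Z)) (erefl (n + 1 - r%:Z))) (untransl_n erefl)).
Qed.

Lemma untransl_boundaries (B : cpx R r.+1) p n (x : untransl B p n) :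
  x \in boundaries (untransl B) p n <->
  (x : B (2 * p - n) p) \in boundaries B (2 * p - n) p.
Proof.
by rewrite (boundaryP (prev_p r p) (prev_n r n)) (boundaryP (A := B)
  (untransl_p (prev_p r p) (prev_n r n)) (untransl_n (prev_p r p))).
Qed.

Definition homology_untransl (B : cpx R r.+1) p n :
    {linear homology B (2 * p - n) p -> homology (untransl B) p n} :=
  @subquot_map R (B (2 * p - n) p) (untransl B p n) _ _
    (cycles (untransl B) p n) (boundaries (untransl B) p n) idfun
    (fun x => (untransl_cycles x).2) (fun x => (untransl_boundaries x).2).

Lemma in_class_untransl (B : cpx R r.+1) p n
    (c : homology B (2 * p - n) p) (x : B (2 * p - n) p) :
  in_class c x -> in_class (homology_untransl B p n c) x.
Proof.
move=> [zx ->]; rewrite subquot_mapE.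
exists ((untransl_cycles (B := B) (p := p) (n := n) x).2 zx).
by congr subquot_pi; exact: val_inj.
Qed.

Lemma in_class_untransl_inv (B : cpx R r.+1) p n
    (c : homology B (2 * p - n) p) (x : untransl B p n) :
  in_class (homology_untransl B p n c) x ->
  in_class c (x : B (2 * p - n) p).
Proof.
have [y cy] := in_class_ex c => cx.
have := (in_class_eq cx (in_class_untransl cy)).1 erefl.
by move/untransl_boundaries; exact: in_class_sub.
Qed.

Fact transl_untransl_diff (B : cpx R r.+1) p n p' n' (e1 : p' = p - r.+1%:Z)
    (e2 : n' = n + 1 - r.+1%:Z) (x : transl (untransl B) p n) :
  cast B (transl_pK p' n') erefl (diff (transl (untransl B)) e1 e2 x) =
  diff B e1 e2 (cast B (transl_pK p n) erefl x).
Proof.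
have e1' : p' = 2 * n - (2 * n - p) - r.+1%:Z by rewrite transl_pK.
by rewrite (diff_cast _ _ _ _ e1' e2) /= (cast_diff _ _ _ _ e1' e2).
Qed.

Definition transl_untransl (B : cpx R r.+1) : cpxhom (transl (untransl B)) B :=
  @Cpxhom R r.+1 (transl (untransl B)) B
    (fun p n => cast B (transl_pK p n) erefl) (@transl_untransl_diff B).

Lemma transl_untransl_iso (B : cpx R r.+1) :
  @is_iso (CpxCat R r.+1) _ _ (transl_untransl B).
Proof. by apply/cpxiso_bij => p n; exact: cast_bij. Qed.

(** Translation is an isomorphism of categories, so maps out of a translate
    correspond to maps into an inverse translate. *)
Section Transpose.
Variables (A : cpx R r) (B : cpx R r.+1) (g : cpxhom (transl A) B).

Let tr p n : {linear A p n -> untransl B p n} :=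
  g (2 * p - n) p \o cast A erefl (esym (transl_pK n p)).

Fact transpose_diff p n p' n' (e1 : p' = p - r%:Z) (e2 : n' = n + 1 - r%:Z)
    (x : A p n) :
  tr p' n' (diff A e1 e2 x) = diff (untransl B) e1 e2 (tr p n x).
Proof.
apply: etrans (cpx_map_diff g (untransl_p e1 e2) (untransl_n e1) _).
congr (g _ _ _).
have e2' : 2 * p' - (2 * p' - n') = n + 1 - r%:Z by rewrite transl_pK.
by rewrite (cast_diff _ _ _ _ e1 e2') /= (diff_cast _ _ _ _ e1 e2').
Qed.

Definition transpose : cpxhom A (untransl B) := Cpxhom transpose_diff.

Lemma transposeE p n (x : A p n) :
  transpose p n x = g (2 * p - n) p (cast A erefl (esym (transl_pK n p)) x).
Proof. by []. Qed.

Lemma transposeK p n (x : transl A p n) :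
  transl_untransl B p n (transpose n (2 * n - p) x) = g p n x.
Proof.
(* Generalizing 2 n - (2 n - p) to q makes both transports eliminable. *)
have aux q (e : q = p) (e' : 2 * n - p = 2 * n - q) (x0 : A n (2 * n - p)) :
    cast B e erefl (g q n (cast A erefl e' x0)) = g p n x0.
  by case: p / e e' x x0 => e' x x0; rewrite !cast_id.
exact: aux.
Qed.

End Transpose.

Section Full.
Variables (A B : cpx R r) (g : cpxhom (transl A) (transl B)).

Let un p n : {linear A p n -> B p n} :=
  cast B erefl (transl_pK n p) \o transpose g p n.

Let unE p n (x : transl A p n) : un n (2 * n - p) x = g p n x.
Proof.
have aux q (e : q = p) (e' : 2 * n - p = 2 * n - q)
    (e'' : 2 * n - q = 2 * n - p) (x0 : A n (2 * n - p)) :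
    cast B erefl e'' (g q n (cast A erefl e' x0)) = g p n x0.
  by case: p / e e' e'' x x0 => e' e'' x x0; rewrite !cast_id.
by apply: aux; exact: transl_pK.
Qed.

Fact untransl_hom_diff p n p' n' (e1 : p' = p - r%:Z) (e2 : n' = n + 1 - r%:Z)
    (x : A p n) :
  un p' n' (diff A e1 e2 x) = diff B e1 e2 (un p n x).
Proof.
rewrite /un [LHS]/= -transposeE.
rewrite [X in cast _ _ _ X](cpx_map_diff (transpose g) e1 e2 x).
have e2' : n' = 2 * p - (2 * p - n) + 1 - r%:Z by rewrite transl_pK.
rewrite [RHS](diff_cast _ _ _ _ e1 e2').
by rewrite [LHS](cast_diff _ _ _ _ e1 e2').
Qed.

Definition untransl_hom : cpxhom A B := Cpxhom untransl_hom_diff.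

Lemma transl_full : exists f : cpxhom A B, transl_map f = g.
Proof. by exists untransl_hom; apply: cpxhom_ext => p n x; exact: unE. Qed.

End Full.
End Translation.
End Cast.

(** * The decalage of an extended spectral sequence and its counit *)

Section Decalage.
Variables (R : comPzRingType) (X : espse R).
Implicit Types p n : int.

Let d1 p n : {linear X 1%N p n -> X 1%N (p - 1%:Z) (n + 1 - 1%:Z)} :=
  diff (X 1%N) erefl erefl.

(** An element x1 of page 1 together with a representative x0 on page 0 of its
    characteristic class and a representative y0 of that of d1 x1. The fourth
    component y1 of the usual description is d1 x1. *)
Definition is_witness p n
    (w : X 0%N p n * X 1%N p n * X 0%N (p - 1%:Z) (n + 1 - 1%:Z)) : bool :=
  `[< in_class (char X 0 p n w.1.2) w.1.1 /\
      in_class (char X 0 _ _ (d1 p n w.1.2)) w.2 >].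

Fact witness_closed p n : submod_closed (@is_witness p n).
Proof.
split=> [|a v w /asboolP [v1 v2] /asboolP [w1 w2]]; apply/asboolP => /=.
  by rewrite !linear0; split; exact: in_class0.
by rewrite !linearP; split; exact: in_class_linear.
Qed.
HB.instance Definition _ p n := GRing.isSubmodClosed.Build R
  (X 0%N p n * X 1%N p n * X 0%N (p - 1%:Z) (n + 1 - 1%:Z))%type
  (@is_witness p n) (@witness_closed p n).

Definition witness p n := submod (GRing.SubmodClosed.clone R
  (X 0%N p n * X 1%N p n * X 0%N (p - 1%:Z) (n + 1 - 1%:Z))%type
  (@is_witness p n) _).
HB.instance Definition _ p n := GRing.Lmodule.on (witness p n).

Definition wit0 p n : {linear witness p n -> X 0%N p n} :=
  fst \o (fst \o @submod_val _ _ _).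
Definition wit1 p n : {linear witness p n -> X 1%N p n} :=
  snd \o (fst \o @submod_val _ _ _).
Definition witd p n : {linear witness p n -> X 0%N (p - 1%:Z) (n + 1 - 1%:Z)} :=
  snd \o @submod_val _ _ _.

Lemma wit_ext p n (w w' : witness p n) :
  wit0 p n w = wit0 p n w' -> wit1 p n w = wit1 p n w' ->
  witd p n w = witd p n w' -> w = w'.
Proof.
case: w w' => [[[a b] c] h] [[[a' b'] c'] h'] /= e1 e2 e3.
by apply: val_inj; rewrite /= e1 e2 e3.
Qed.

Lemma wit_class p n (w : witness p n) :
  in_class (char X 0 p n (wit1 p n w)) (wit0 p n w).
Proof. by case: w => w /= /asboolP []. Qed.

Lemma wit_class_diff p n p' n' (e1 : p' = p - 1%:Z) (e2 : n' = n + 1 - 1%:Z)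
    (w : witness p n) :
  in_class (char X 0 p' n' (diff (X 1%N) e1 e2 (wit1 p n w)))
           (cast (X 0%N) (esym e1) (esym e2) (witd p n w)).
Proof.
subst p' n'; rewrite cast_id.
by case: w => w /= /asboolP [].
Qed.

Lemma wit_ex p n x0 x1 y0 :
  in_class (char X 0 p n x1) x0 -> in_class (char X 0 _ _ (d1 p n x1)) y0 ->
  exists w : witness p n,
    [/\ wit0 p n w = x0, wit1 p n w = x1 & witd p n w = y0].
Proof.
move=> h h'.
have hw : (x0, x1, y0) \in @is_witness p n by apply/asboolP.
by exists (Submod hw).
Qed.

(** The image of a witness (x0, x1, y0) is again one: y0 represents the class of
    d1 x1, and d1 (d1 x1) = 0 is represented by 0. *)
Fact wit_diff_subproof p n p' n' (e1 : p' = p - 1%:Z) (e2 : n' = n + 1 - 1%:Z)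
    (w : witness p n) :
  (cast (X 0%N) (esym e1) (esym e2) (witd p n w),
   diff (X 1%N) e1 e2 (wit1 p n w), 0) \in @is_witness p' n'.
Proof.
apply/asboolP; split; first exact: wit_class_diff.
by rewrite /d1 diff_diff !linear0; exact: in_class0.
Qed.

Definition wit_diff_fun p n p' n' (e1 : p' = p - 1%:Z)
  (e2 : n' = n + 1 - 1%:Z) (w : witness p n) : witness p' n' :=
  Submod (wit_diff_subproof e1 e2 w).

Fact wit_diff_linear p n p' n' (e1 : p' = p - 1%:Z)
  (e2 : n' = n + 1 - 1%:Z) : linear (@wit_diff_fun p n p' n' e1 e2).
Proof.
move=> a v w; apply: val_inj.
by rewrite /= !linearP /=; congr pair; rewrite /= scaler0 addr0.
Qed.
HB.instance Definition _ p n p' n' (e1 : p' = p - 1%:Z)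
  (e2 : n' = n + 1 - 1%:Z) := GRing.isLinear.Build R _ _ _
  (@wit_diff_fun p n p' n' e1 e2) (@wit_diff_linear p n p' n' e1 e2).

Fact wit_diff_diff p n p' n' p'' n''
    (e1 : p' = p - 1%:Z) (e2 : n' = n + 1 - 1%:Z)
    (e3 : p'' = p' - 1%:Z) (e4 : n'' = n' + 1 - 1%:Z) (w : witness p n) :
  wit_diff_fun e3 e4 (wit_diff_fun e1 e2 w) = 0.
Proof. by apply: val_inj; rewrite /= diff_diff linear0. Qed.

Definition wit_cpx : cpx R 1 :=
  @Cpx R 1 witness (fun p n p' n' e1 e2 => @wit_diff_fun p n p' n' e1 e2)
    wit_diff_diff.

Definition rho : cpxhom wit_cpx (X 1%N) :=
  @Cpxhom R 1 wit_cpx (X 1%N) wit1 (fun _ _ _ _ _ _ _ => erefl).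

Lemma wit0_diff p n p' n' (e1 : p' = p - 1%:Z) (e2 : n' = n + 1 - 1%:Z)
    (w : witness p n) :
  wit0 p' n' (diff wit_cpx e1 e2 w) =
  cast (X 0%N) (esym e1) (esym e2) (witd p n w).
Proof. by []. Qed.

Lemma wit1_diff p n p' n' (e1 : p' = p - 1%:Z) (e2 : n' = n + 1 - 1%:Z)
    (w : witness p n) :
  wit1 p' n' (diff wit_cpx e1 e2 w) = diff (X 1%N) e1 e2 (wit1 p n w).
Proof. by []. Qed.

Lemma witd_diff p n p' n' (e1 : p' = p - 1%:Z) (e2 : n' = n + 1 - 1%:Z)
    (w : witness p n) : witd p' n' (diff wit_cpx e1 e2 w) = 0.
Proof. by []. Qed.

(** A cycle of X 1 lifts with y0 = 0 and any representative x0. If x1 = d1 z,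
    then a cycle (x0, x1, 0) is the differential of (z0, z, x0) for any
    representative z0 of the characteristic class of z. *)
Lemma rho_quasi_iso : quasi_iso rho.
Proof.
apply/quasi_isoP; split=> p n.
  move=> w /(cycleP (A := wit_cpx) erefl erefl) dw bw.
  have w0 : witd p n w = 0.
    by have := congr1 (@wit0 _ _) dw; rewrite linear0 wit0_diff cast_id.
  case/(boundaryP (prev_p 1 p) (prev_n 1 n)): bw => z zE.
  have [z0 z0P] := in_class_ex (char X 0 _ _ z).
  have [|v [_ v1 vd]] := wit_ex
      (y0 := cast (X 0%N) (prev_p 1 p) (prev_n 1 n) (wit0 p n w)) z0P.
    suff -> : d1 _ _ z = cast (X 1%N) (prev_p 1 p) (prev_n 1 n) (wit1 p n w).
      exact/in_class_char_cast/wit_class.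
    by rewrite -[wit1 p n w]zE (cast_diff _ _ _ _ erefl erefl).
  apply/(boundaryP (A := wit_cpx) (prev_p 1 p) (prev_n 1 n)); exists v.
  apply: wit_ext.
  - by rewrite wit0_diff vd castK.
  - by rewrite wit1_diff v1.
  - by rewrite w0.
move=> x zx; have [x0 x0P] := in_class_ex (char X 0 p n x).
have dx : d1 p n x = 0 by apply/(cycleP erefl erefl).
have [|w [_ w1 wd]] := wit_ex (y0 := 0) x0P.
  by rewrite dx linear0; exact: in_class0.
exists w; last by rewrite [rho p n w]w1 subrr rpred0.
apply/(cycleP (A := wit_cpx) erefl erefl); apply: wit_ext.
- by rewrite wit0_diff wd !linear0.
- by rewrite wit1_diff w1 linear0.
- by rewrite linear0.
Qed.

Lemma rho_inv : {h : bghom (homology (X 1%N)) (homology wit_cpx) |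
  forall p n c, homology_map rho p n (h p n c) = c}.
Proof.
apply: cid; have [h [_ hK]] := rho_quasi_iso; exists h => p n c.
exact: (congr1 (fun k : bghom (homology (X 1%N)) _ => k p n c) hK).
Qed.

(** Inverting [rho] on homology does not disturb representatives. *)
Lemma in_class_rho_inv p n c (w : witness p n) :
  w \in cycles wit_cpx p n -> in_class c (wit1 p n w) ->
  in_class (projT1 rho_inv p n c) w.
Proof.
move=> zw cw; have [c' c'w] := cycle_in_class zw.
suff -> : projT1 rho_inv p n c = c' by [].
have /bgiso_bij/(_ p n)/bij_inj := rho_quasi_iso; apply.
rewrite [LHS](projT2 rho_inv).
exact: in_class_inj cw (in_class_map rho c'w).
Qed.

Lemma in_class_rho p n c (w : witness p n) :
  in_class (projT1 rho_inv p n c) w -> in_class c (wit1 p n w).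
Proof. by move/(in_class_map rho); rewrite (projT2 rho_inv). Qed.

Definition dec_page (i : nat) : cpx R i :=
  match i with
  | 0 => untransl wit_cpx
  | j.+1 => untransl (X j.+2)
  end.

Definition dec_char (i : nat) : bghom (dec_page i.+1) (homology (dec_page i)) :=
  match i with
  | 0 => fun p n => homology_untransl wit_cpx p n \o
           (projT1 rho_inv (2 * p - n) p \o char X 1 (2 * p - n) p)
  | j.+1 => fun p n => homology_untransl (X j.+2) p n \o
           char X j.+2 (2 * p - n) p
  end.

Definition dec : espse R := ESpSeq dec_char.

Fact wit0_zero_diff p n p' n' (e1 : p' = p - 0%:Z) (e2 : n' = n + 1 - 0%:Z)
    (w : witness p n) : diff (X 0%N) e1 e2 (wit0 p n w) = 0.
Proof. exact/(cycleP e1 e2)/(in_class_cycle (wit_class w)). Qed.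

Let wit0_transl p n : {linear transl (untransl wit_cpx) p n -> X 0%N p n} :=
  wit0 p n \o transl_untransl wit_cpx p n.

Fact wit0_transl_diff p n p' n' (e1 : p' = p - 0%:Z) (e2 : n' = n + 1 - 0%:Z)
    (w : transl (untransl wit_cpx) p n) :
  wit0_transl p' n' 0 = diff (X 0%N) e1 e2 (wit0_transl p n w).
Proof. by rewrite linear0 wit0_zero_diff. Qed.

Definition counit0 : cpxhom (zero_diff 0 (transl (untransl wit_cpx))) (X 0%N) :=
  @Cpxhom R 0 (zero_diff 0 (transl (untransl wit_cpx))) (X 0%N) wit0_transl
    wit0_transl_diff.

Definition counit_page (i : nat) : cpxhom (shift dec i) (X i) :=
  match i with
  | 0 => counit0
  | 1 => cpxcomp rho (transl_untransl wit_cpx)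
  | j.+2 => transl_untransl (X j.+2)
  end.

Fact counit_char i p n x z :
  in_class (char (shift dec) i p n x) z ->
  in_class (char X i p n (counit_page i.+1 p n x)) (counit_page i p n z).
Proof.
case: i x z => [|[|j]] x z.
- move=> xz; rewrite -(in_class_zero_diff_inj (in_class_zero_diff 0 _) xz).
  exact: wit_class.
- move/in_class_transl_inv/in_class_untransl_inv/in_class_rho => xz.
  have := in_class_char_cast (transl_pK p n) erefl xz.
  by rewrite -map_cast.
move/in_class_transl_inv/in_class_untransl_inv => xz.
have := in_class_char_cast (transl_pK p n) erefl xz.
exact.
Qed.

Definition counit : espse_hom (shift dec) X :=
  ESpSeHom (char_map_of_class counit_char).

End Decalage.

(** * Universality of the counit *)

(** A map g out of the shift of A sends an element x of page 0 of A to the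
    witness (g 0 x, g 1 x, g 0 (d x)), because the first characteristic map of a
    shift is the identity. *)
Section Transposition.
Variables (R : comPzRingType) (A X : espse R) (g : espse_hom (shift A) X).
Implicit Types p n : int.

Let g0 p n : {linear transl (A 0%N) p n -> X 0%N p n} := g 0%N p n.
Let g1 : cpxhom (transl (A 0%N)) (X 1%N) := g 1%N.

Let g01 p n (x : transl (A 0%N) p n) :
  in_class (char X 0 p n (g1 p n x)) (g0 p n x).
Proof.
exact: (char_map_in_class g (in_class_zero_diff 0 x)).
Qed.

Fact to_wit_subproof p n (x : transl (A 0%N) p n) :
  (g0 p n x, g1 p n x, g0 _ _ (diff (transl (A 0%N)) erefl erefl x))
    \in @is_witness R X p n.
Proof. by apply/asboolP; split=> //=; rewrite -cpx_map_diff; exact: g01. Qed.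

Definition to_wit_fun p n (x : transl (A 0%N) p n) : witness X p n :=
  Submod (to_wit_subproof x).

Fact to_wit_linear p n : linear (@to_wit_fun p n).
Proof. by move=> a x y; apply: val_inj; rewrite /= !linearP. Qed.
HB.instance Definition _ p n := GRing.isLinear.Build R _ _ _
  (@to_wit_fun p n) (@to_wit_linear p n).

Fact to_wit_diff p n p' n' (e1 : p' = p - 1%:Z) (e2 : n' = n + 1 - 1%:Z)
    (x : transl (A 0%N) p n) :
  to_wit_fun (diff (transl (A 0%N)) e1 e2 x) =
  diff (wit_cpx X) e1 e2 (to_wit_fun x).
Proof.
subst p' n'; apply: wit_ext.
- by rewrite wit0_diff cast_id.
- by rewrite wit1_diff; exact: (cpx_map_diff g1).
by rewrite witd_diff /witd /= (diff_diff (c := transl (A 0%N))) linear0.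
Qed.

Definition to_wit : cpxhom (transl (A 0%N)) (wit_cpx X) :=
  @Cpxhom R 1 (transl (A 0%N)) (wit_cpx X) (fun p n => @to_wit_fun p n)
    to_wit_diff.

Definition dec_tr_page (i : nat) : cpxhom (A i) (dec X i) :=
  match i with
  | 0 => transpose to_wit
  | j.+1 => transpose (g j.+2)
  end.

Fact dec_tr_char i p n x z :
  in_class (char A i p n x) z ->
  in_class (char (dec X) i p n (dec_tr_page i.+1 p n x)) (dec_tr_page i p n z).
Proof.
move=> /(in_class_char_cast erefl (esym (transl_pK n p))) xz.
have xz' : in_class
    (char (shift A) i.+1 (2 * p - n) p
      (cast _ erefl (esym (transl_pK n p)) x))
    (cast _ erefl (esym (transl_pK n p)) z : shift A i.+1 (2 * p - n) p).
  exact: in_class_transl.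
have {}xz' := char_map_in_class g xz'.
case: i x z xz xz' => [|j] x z xz xz'; last exact: in_class_untransl.
apply: in_class_untransl; apply: in_class_rho_inv; last exact: xz'.
apply: (@cpxhom_cycle R 1 _ _ to_wit); apply/transl_cycles.
exact: in_class_cycle xz.
Qed.

Definition dec_tr : espse_hom A (dec X) :=
  ESpSeHom (char_map_of_class dec_tr_char).

Lemma dec_trK : espse_comp (counit X) (shift_map dec_tr) = g.
Proof.
apply: espse_hom_ext => -[|[|j]] p n x.
- by rewrite -[RHS]/(wit0 X p n (to_wit p n x)) -transposeK.
- by rewrite -[RHS]/(wit1 X p n (to_wit p n x)) -transposeK.
exact: transposeK.
Qed.

End Transposition.

Section Uniqueness.
Variables (R : comPzRingType) (A X : espse R) (g h : espse_hom A (dec X)).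

(** A witness w is determined by x0 and x1 for w and by x0 for its differential,
    and the counit reads off exactly these. *)
Lemma counit_inj :
  espse_comp (counit X) (shift_map g) = espse_comp (counit X) (shift_map h) ->
  g = h.
Proof.
move=> gh; apply: espse_hom_ext => i; apply: transl_bideg => p n x.
have E j q m (y : shift A j q m) :=
  congr1 (fun k : espse_hom _ _ => k j q m y) gh.
case: i x => [|j] x; last first.
  have /bij_inj := cast_bij (X j.+2) (transl_pK p n) (erefl n); apply.
  exact: (E j.+2).
have /bij_inj := cast_bij (wit_cpx X) (transl_pK p n) (erefl n); apply.
pose G (k : espse_hom A (dec X)) : cpxhom (transl (A 0%N)) (wit_cpx X) :=
  cpxcomp (transl_untransl (wit_cpx X)) (transl_map (k 0%N)).
suff : G g p n x = G h p n x by [].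
apply: wit_ext; [exact: (E 0%N) | exact: (E 1%N) |].
have := E 0%N _ _
  (diff (transl (A 0%N)) (erefl (p - 1%:Z)) (erefl (n + 1 - 1%:Z)) x).
rewrite -[LHS]/(wit0 X _ _ (G g _ _ _)) -[RHS]/(wit0 X _ _ (G h _ _ _)).
by rewrite !cpx_map_diff !wit0_diff !cast_id.
Qed.

End Uniqueness.

(** * Shift, decalage and the two Quillen equivalences *)

Section Shift.
Variable R : comPzRingType.

Lemma shift_map_inj (X Y : espse R) (f g : espse_hom X Y) :
  shift_map f = shift_map g -> f = g.
Proof.
move=> fg; apply: espse_hom_ext => i; apply: transl_bideg => p n x.
have := congr1 (fun k : espse_hom (shift X) (shift Y) => k i.+1 p n x) fg.
exact.
Qed.

(** The first characteristic map of a shift is the identity, so the component on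
    page 0 is forced to agree with that on page 1. *)
Lemma shift_map_full (X Y : espse R) (g : espse_hom (shift X) (shift Y)) :
  exists f : espse_hom X Y, shift_map f = g.
Proof.
pose t i := cid (transl_full (A := X i) (B := Y i) (g i.+1)).
pose f i : cpxhom (X i) (Y i) := projT1 (t i).
have fE i p n x : f i n (2 * n - p) x = g i.+1 p n x.
  by rewrite -(projT2 (t i)).
have fc i p n (x : X i.+1 p n) (z : X i p n) :
    in_class (char X i p n x) z ->
    in_class (char Y i p n (f i.+1 p n x)) (f i p n z).
  move: p n x z; apply: transl_bideg => p n x z xz.
  have {}xz : in_class (char (shift X) i.+1 p n x) (z : shift X i.+1 p n).
    exact: in_class_transl.
  have {xz} := char_map_in_class g xz; rewrite -!fE.
  exact: in_class_transl_inv.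
exists (ESpSeHom (char_map_of_class fc)).
apply: espse_hom_ext => -[|i] p n x /=; last exact: fE.
rewrite fE; have h1 := char_map_in_class g (in_class_zero_diff 0 x).
exact: in_class_zero_diff_inj (in_class_zero_diff 0 _) h1.
Qed.

(** Cofibrancy is a condition on maps out of initial objects; it yields sections
    of trivial fibrations only once such an object is exhibited. *)
Definition zero_espse : espse R :=
  @ESpSeq R (fun i => zero_diff i (fun _ _ => 'rV[R]_0)) (fun _ _ _ => \0).

Lemma zero_espse_initial : @is_initial (ESpSe R) zero_espse.
Proof.
move=> X.
have zd i p n p' n' (e1 : p' = p - i%:Z) (e2 : n' = n + 1 - i%:Z)
    (x : zero_espse i p n) : 0 = diff (X i) e1 e2 (0 : X i p n).
  by rewrite linear0.
pose z i : cpxhom (zero_espse i) (X i) :=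
  @Cpxhom R i (zero_espse i) (X i) (fun _ _ => \0) (@zd i).
have zc i p n (x : zero_espse i.+1 p n) (y : zero_espse i p n) :
    in_class (char zero_espse i p n x) y ->
    in_class (char X i p n (z i.+1 p n x)) (z i p n y).
  by move=> _; rewrite /= linear0; exact: in_class0.
exists (ESpSeHom (char_map_of_class zc)); split=> // f _.
apply: espse_hom_ext => i p n x; rewrite /=.
by rewrite [x]thinmx0 linear0.
Qed.

(** A representative on the target differs from the image of one on the source
    by a boundary, and surjectivity lifts that boundary. *)
Lemma lift_class (X Y : espse R) (f : espse_hom X Y) (i : nat) p n
    (x : X i.+1 p n) (y : Y i p n) :
  bgsurjective (f i) -> in_class (char Y i p n (f i.+1 p n x)) y ->
  exists2 z, in_class (char X i p n x) z & f i p n z = y.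
Proof.
move=> fs fxy; have [z xz] := in_class_ex (char X i p n x).
have := (in_class_eq fxy (char_map_in_class f xz)).1 erefl.
case/(boundaryP (prev_p i p) (prev_n i n)) => w wE; have [v vE] := fs _ _ w.
exists (z + diff (X i) (prev_p i p) (prev_n i n) v); last first.
  by rewrite linearD cpx_map_diff vE wE addrC subrK.
apply: in_class_sub xz _; rewrite addrC addKr.
by apply/(boundaryP (prev_p i p) (prev_n i n)); exists v.
Qed.

Definition dec_functor : functor (ESpSe R) (ESpSe R) :=
  @univ_functor (ESpSe R) (ESpSe R) (Shift R) (@dec R) (@counit R)
    (@dec_tr R) (@dec_trK R) (@counit_inj R).

Definition shift_dec : adjunction (Shift R) dec_functor :=
  @univ_adjunction (ESpSe R) (ESpSe R) (Shift R) (@dec R) (@counit R)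
    (@dec_tr R) (@dec_trK R) (@counit_inj R).

(** Lift the page 1 component of a witness first, then the two representatives
    by [lift_class]. *)
Lemma dec_surj0 (X Y : espse R) (f : espse_hom X Y) :
  bgsurjective (f 0%N) -> bgsurjective (f 1%N) ->
  bgsurjective (page_map (fmap dec_functor f : espse_hom (dec X) (dec Y)) 0).
Proof.
move=> f0 f1; apply: transl_bideg => p n y.
have tinj := bij_inj (cast_bij (wit_cpx Y) (transl_pK p n) (erefl n)).
have [_ tsurj] :=
  (bij_inj_surj _).1 (cast_bij (wit_cpx X) (transl_pK p n) (erefl n)).
set w : witness Y p n := cast (wit_cpx Y) (transl_pK p n) erefl y.
have [x1 x1E] := f1 _ _ (wit1 Y p n w).
have [|x0 x0P x0E] := lift_class (x := x1) (y := wit0 Y p n w) f0.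
  by rewrite x1E; exact: wit_class.
have [|xd xdP xdE] := lift_class
    (x := diff (X 1%N) (erefl (p - 1%:Z)) (erefl (n + 1 - 1%:Z)) x1)
    (y := witd Y p n w) f0.
  rewrite cpx_map_diff x1E.
  by have := wit_class_diff erefl erefl w; rewrite cast_id.
have [v [v0 v1 vd]] := wit_ex x0P xdP; have [x xE] := tsurj v.
exists x; apply: tinj; rewrite -/w.
apply: etrans (transposeK _ _) _; apply: wit_ext.
- by rewrite -x0E -v0 -xE.
- by rewrite -x1E -v1 -xE.
rewrite -xdE -vd -xE.
rewrite -[LHS]/(f 0%N _ _ (wit0 X _ _ (transl_untransl (wit_cpx X) _ _
  (diff (transl (untransl (wit_cpx X))) erefl erefl x)))).
by rewrite cpx_map_diff wit0_diff cast_id.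
Qed.

Lemma dec_surj (X Y : espse R) (f : espse_hom X Y) j :
  bgsurjective (f j.+2) ->
  bgsurjective (page_map (fmap dec_functor f : espse_hom (dec X) (dec Y)) j.+1).
Proof.
move=> fs; apply: transl_bideg => p n y.
have tinj := bij_inj (cast_bij (Y j.+2) (transl_pK p n) (erefl n)).
have [_ tsurj] :=
  (bij_inj_surj _).1 (cast_bij (X j.+2) (transl_pK p n) (erefl n)).
have [z zE] := fs _ _ (cast (Y j.+2) (transl_pK p n) erefl y).
have [x xE] := tsurj z; exists x; apply: tinj.
by apply: etrans (transposeK _ _) _; rewrite -zE -xE.
Qed.

Lemma iso_page (X Y : ESpSe R) (f : hom X Y) i :
  is_iso f -> @is_iso (CpxCat R i) (X i) (Y i) (f i).
Proof.
move=> [g [gf fg]]; exists (g i); split.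
  exact: (congr1 (fun k : espse_hom X X => page_map k i) gf).
exact: (congr1 (fun k : espse_hom Y Y => page_map k i) fg).
Qed.

Lemma iso_quasi_iso i (A B : CpxCat R i) (f : hom A B) :
  is_iso f -> quasi_iso f.
Proof. exact: is_iso_fmap. Qed.

Lemma counit_iso (X : espse R) j :
  @is_iso (CpxCat R j.+2) _ _ (counit X j.+2).
Proof. exact: transl_untransl_iso. Qed.

Lemma counit_quasi_iso (X : espse R) j : quasi_iso (counit X j.+1).
Proof.
case: j => [|j]; last exact/iso_quasi_iso/counit_iso.
rewrite /quasi_iso -[fmap _ _]/(fmap (@Homology R 1)
  (@mcomp (CpxCat R 1) _ _ _ (rho X) (transl_untransl (wit_cpx X)))) fmap_comp.
apply: iso_comp (rho_quasi_iso X).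
exact/iso_quasi_iso/transl_untransl_iso.
Qed.

End Shift.

Theorem proposition7p4p1 (R : comPzRingType) (r : nat)
    (M N : model_structure (ESpSe R))
    (hM : is_ESpSe' r M) (hN : is_ESpSe' r.+1 N) :
  (forall (Dec : functor (ESpSe R) (ESpSe R)) (a : adjunction (Shift R) Dec),
     quillen_equivalence M N a) /\
  (forall (LDec : functor (ESpSe R) (ESpSe R)) (a : adjunction LDec (Shift R)),
     quillen_equivalence N M a).
Proof.
have [fibM weqM] := hM; have [fibN weqN] := hN.
have weqF (X Y : ESpSe R) (f : hom X Y) : weq M f <-> weq N (fmap (Shift R) f).
  rewrite weqM weqN -(quasi_iso_transl (f r)).
  split=> -[qf isof]; split=> //; last first.
    by move=> i ri; exact/iso_transl/(isof i.+1).
  by case=> [//|i] ri; exact/iso_transl/isof.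
have weq_counit (Y : ESpSe R) (e : hom (Shift R (dec_functor R Y)) Y) :
    adj (shift_dec R) e = idm (dec_functor R Y) -> weq N e.
  move=> aE; have <- : @counit R Y = e.
    have := dec_trK (e : espse_hom (shift (dec Y)) Y).
    rewrite (aE : dec_tr (e : espse_hom (shift (dec Y)) Y) = espse_id _).
    by rewrite shift_map_id espse_compm1.
  apply/weqN; split; first exact: counit_quasi_iso.
  by case=> [|[|j]] // _; exact: counit_iso.
have fibD (X Y : ESpSe R) (p : hom X Y) :
    fib N p -> fib M (fmap (dec_functor R) p).
  move=> /fibN fp; apply/fibM => -[|j] jr; first by apply: dec_surj0; exact: fp.
  by apply: dec_surj; exact: fp.
have fibF (X Y : ESpSe R) (p : hom X Y) : fib M p -> fib N (fmap (Shift R) p).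
  move=> /fibM fp; apply/fibN => -[|j] jr; apply: surj_transl; exact: fp.
split=> [D a|L a].
  exact: left_adjoint_equivalence weqF weq_counit fibD _ a.
have weq_iso (X Y : ESpSe R) (f : hom X Y) : is_iso f -> weq M f.
  move=> isof; apply/weqM; split; first exact/iso_quasi_iso/iso_page.
  by move=> i _; exact: iso_page.
apply: (right_adjoint_equivalence weqF weq_counit).
- exact: fibF.
- exact: shift_map_inj.
- exact: shift_map_full.
- exact: weq_iso.
exact: zero_espse_initial.
Qed.
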